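(* Let $(\alpha_n)_{n=1}^\infty$ be a sequence of cardinal numbers and let $\mathcal R$ be a dense operator range of type $\mathsf R(\alpha_n)_{n=1}^\infty$ in a Hilbert space $H$ of dimension $\alpha\ge\aleph_0$. The following conditions are equivalent: (a) there exists a closed linear subspace $Z$ of $H$ such that $Z\cap\mathcal R=\{0\}$ and $\dim(Z)=\alpha$; (b) for any cardinal $\beta<\alpha$ there exists a closed linear subspace $Y$ of $H$ such that $Y\cap\mathcal R=\{0\}$ and $\dim(Y)>\beta$; (c) for any cardinal $\beta<\alpha$ and any integer $n>0$ there is $m>n$ such that $\sum_{j=n+1}^m\alpha_j>\beta$; (d) $\dim(K^\perp)=\alpha$ for any linear subspace $K$ of $\mathcal R$ that is closed in $H$; (e) there exists a dense operator range $\mathcal R'$ in $H$ such that $\mathcal R'\cap\mathcal R=\{0\}$; (f) there exists a unitary operator $U$ on $H$ for which $U(\mathcal R)\cap\mathcal R=\{0\}$; (g) there exists a closed linear subspace $W$ of $H$ such that $W\cap\mathcal R=W^\perp\cap\mathcal R=\{0\}$. Moreover, $\dim(W)=\dim(W^\perp)=\alpha$ for any $W$ witnessing (g).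
   Context: All Hilbert spaces are complex; $\dim$ denotes Hilbert space dimension (cardinality of an orthonormal basis). A linear subspace $\mathcal R$ of a Hilbert space $H$ is an operator range if $\mathcal R=T(K)$ for some Hilbert space $K$ and some bounded linear operator $T\colon K\to H$. An operator range $\mathcal R$ in $H$ is of type $\mathsf R(\alpha_n)_{n=1}^\infty$ (with $\alpha_n$ cardinals, possibly $0$) if there are mutually orthogonal closed linear subspaces $H_1,H_2,\ldots$ of $H$ (possibly zero) with $\dim(H_n)=\alpha_n$ for all $n>0$ and $$\mathcal R=\Bigl\{\oplus_{n=1}^\infty x_n\in\bigoplus_{n=1}^\infty H_n:\ \sum_{n=1}^\infty(2^n\|x_n\|)^2<\infty\Bigr\}.$$ *)

(* Defs.v *)
From HB Require Import structures.
From mathcomp Require Import all_boot all_order all_algebra sesquilinear.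
From mathcomp Require Import all_classical all_reals all_analysis.
From mathcomp Require Import complex.

Set Implicit Arguments.
Unset Strict Implicit.
Unset Printing Implicit Defensive.

Import Order.TTheory GRing.Theory Num.Theory.
Import numFieldNormedType.Exports.

Local Open Scope classical_set_scope.
Local Open Scope ring_scope.

(* The norm of a normed module over R[i] takes its values in R[i]; being
   nonnegative they are real. The inner product is linear in its first argument
   and conjugate-linear in its second one. *)
HB.mixin Record CompleteNormedModule_isHilbert (R : realType) H
    & CompleteNormedModule R[i] H := {
  hdot : {dot H for (@Num.conj R[i])} ;
  hdot_norm : forall x : H, `|x| ^+ 2 = hdot x x
}.

#[short(type="hilbertType")]
HB.structure Definition Hilbert (R : realType) :=
  {H of CompleteNormedModule R[i] H & CompleteNormedModule_isHilbert R H}.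

(* Cardinals are represented by types, a type standing for its full set, and
   compared with the relations #<= and #= of the library. *)
Definition card_lt T U (A : set T) (B : set U) : Prop :=
  (A #<= B)%card /\ (A #!= B)%card.
Notation "A '#<' B" := (card_lt A B) (at level 79) : card_scope.

Section hilbert.
Context {R : realType}.
Implicit Types H K : hilbertType R.

Definition hnorm H (x : H) : R := complex.Re `|x|.

Definition linear_subspace H (S : set H) : Prop := submod_closed (mem S).

Definition closed_subspace H (S : set H) : Prop :=
  linear_subspace S /\ closed S.

Definition linear_span H (E : set H) : set H := smallest (@linear_subspace H) E.

Definition orthogonal_subspaces H (S T : set H) : Prop :=
  forall x y, S x -> T y -> hdot x y = 0.

Definition orthocomplement H (S : set H) : set H :=
  [set x | forall y, S y -> hdot x y = 0].

Definition orthonormal_set H (E : set H) : Prop :=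
  forall x y, E x -> E y -> hdot x y = (x == y)%:R.

Definition orthonormal_basis H (Z E : set H) : Prop :=
  orthonormal_set E /\ closure (linear_span E) = Z.

(* dim Z is the cardinal of A *)
Definition has_dim H (Z : set H) T (A : set T) : Prop :=
  exists2 E : set H, orthonormal_basis Z E & (E #= A)%card.

(* dim Z is larger than the cardinal of A *)
Definition dim_gt H (Z : set H) T (A : set T) : Prop :=
  exists2 E : set H, orthonormal_basis Z E & (A #< E)%card.

Definition bounded_operator K H (T : {linear K -> H}) : Prop :=
  exists M : R, forall x, hnorm (T x) <= M * hnorm x.

Definition operator_range H (Rg : set H) : Prop :=
  exists (K : hilbertType R) (T : {linear K -> H}),
    bounded_operator T /\ Rg = range T.

Definition unitary_operator H (U : {linear H -> H}) : Prop :=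
  isometry hdot hdot U /\ range U = setT.

(* Sequences start at index 1: the value alpha_ 0 plays no role. The vector
   x = (+)_n x_n of the internal orthogonal sum of the H_ n is the limit of the
   partial sums of the x_ n; the square-summability of the norms which it
   requires follows from that of the 2 ^ n * |x_ n|. *)
Definition range_of_type H (alpha_ : nat -> Type) (Rg : set H) : Prop :=
  exists H_ : nat -> set H,
  [/\ forall n, (0 < n)%N -> closed_subspace (H_ n),
      forall m n, (0 < m)%N -> (0 < n)%N -> m != n ->
        orthogonal_subspaces (H_ m) (H_ n),
      forall n, (0 < n)%N -> has_dim (H_ n) [set: alpha_ n] &
      Rg = [set x | exists x_ : nat -> H,
        [/\ forall n, (0 < n)%N -> H_ n (x_ n),
            \sum_(1 <= n < N) x_ n @[N --> \oo] --> x &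
            (\sum_(1 <= n <oo) ((2 ^+ n * hnorm (x_ n)) ^+ 2)%:E < +oo)%E]]].

End hilbert.

(* Main.v *)
Require Import Defs.
From HB Require Import structures.
From mathcomp Require Import all_boot all_order all_algebra sesquilinear.
From mathcomp Require Import all_classical all_reals all_analysis.
From mathcomp Require Import complex.
From mathcomp Require Import ring lra.

Set Implicit Arguments.
Unset Strict Implicit.
Unset Printing Implicit Defensive.

Import Order.TTheory GRing.Theory Num.Theory.
Import numFieldNormedType.Exports.
Import Normc.

Local Open Scope classical_set_scope.

(** Fix an orthonormal basis [B n] of each [H_ n]. As [Rg] is dense, the union
    [E] of the [B n] is an orthonormal basis of [H], so it has [alpha] elements.
    Let [F n] be the tail of [E] formed by the vectors of level larger than [n].
    All seven conditions are compared with a single combinatorial one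
    ([full_tails]): every tail [F n] has as many elements as [E].

    Dimensions are compared by one principle ([card_le_orthonormal]): if no
    nonzero vector of the span of an orthonormal set [X] is orthogonal to the set
    [Y], then [X] has at most as many elements as [Y]. For finite [Y] this is a
    rank argument. For infinite [Y], each vector of [X] is non-orthogonal to some
    vector of [Y], and by Bessel's inequality each vector of [Y] is so related to
    countably many vectors of [X] only. The principle is fed by two facts: a
    vector orthogonal to [F n] has finitely many components, so it lies in [Rg];
    and the span of [E] lies in [Rg].
    - If [Y] meets [Rg] trivially, so do the vectors of [Y] orthogonal to [F n],
      hence [dim Y] is at most the cardinal of [F n]: (b) gives full tails.
    - If [S] is a bounded operator whose dense range meets [Rg] trivially, only 0
      is orthogonal to all [S (S* f)] with [f] in [F n]: (e) gives full tails.
    - If [K] is closed and contained in [Rg], then a gliding hump shows that the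
      vectors of [K] without components of level at most [n] vanish, for some [n]
      ([closed_subspace_range_head]); so [F n] is not larger than a basis of the
      orthogonal complement of [K], and full tails give (d). Conversely (d) applies
      to the orthogonal complement of [F n].
    - If the orthogonal complement of [W] meets [Rg] trivially, then [E] is not
      larger than a basis of [W]; this is the last claim, and it takes (g) to (a), from which (b) is
      immediate.
    Condition (c) says the same about the finite stretches of levels instead of
    the whole tails.

    The heart is to get (g) from full tails. Zorn's lemma partitions [E] into
    sequences along which the level grows as fast as desired
    ([partition_sequences]). Along two such sequences [p] and [p'], the components
    of a vector of [Rg] decay superexponentially, whereas the matrix
    [A j k = 2 ^ - (j + 1)(k + 1)] sends every nonzero bounded sequence to one that
    decays at most exponentially. So the graph of [A], from the span of the [p k]
    to the span of the [p' j], meets [Rg] trivially, and so does its orthogonal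
    complement, which is the graph of [- A] in the other direction
    ([exists_vandermonde_complements]). Finally (g) gives (f) through the unitary
    reflection in [W], and (f) gives (e) with the image of [Rg]. *)

(** * Comparison of cardinals *)

(** The interface used below: injections and partial inverses between sets whose
    carrier types may be empty. *)
Lemma card_le_inj T U (A : set T) (B : set U) (f : T -> U) :
  (forall x, A x -> B (f x)) -> (forall x y, A x -> A y -> f x = f y -> x = y) ->
  (A #<= B)%card.
Proof.
move=> fAB finj; have fA : {in A &, injective f}.
  by move=> x y /set_mem Ax /set_mem Ay; exact: finj.
rewrite -(card_le_eql (inj_card_eq fA)).
by apply: subset_card_le => _ [x Ax <-]; exact: fAB.
Qed.

Lemma card_le_rel T U (A : set T) (B : set U) (G : T -> U -> Prop) :
  (forall x, A x -> exists2 y, B y & G x y) ->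
  (forall x x' y, A x -> A x' -> G x y -> G x' y -> x = x') ->
  (A #<= B)%card.
Proof.
move=> GAB Ginj; have [->|/set0P[x0 Ax0]] := eqVneq A set0; first exact: card_ge0.
have [y0 _ _] := GAB _ Ax0.
have /choice[f fP] : forall x, exists y, A x -> B y /\ G x y.
  move=> x; have [/GAB[y By Gxy]|nAx] := pselect (A x); first by exists y.
  by exists y0.
apply: (@card_le_inj _ _ _ _ f) => [x /fP[]//|x y Ax Ay fxy].
by apply: (Ginj x y (f x)) => //; [have [] := fP _ Ax|rewrite fxy; have [] := fP _ Ay].
Qed.

Lemma card_le_pinv T U (A : set T) (B : set U) : (A #<= B)%card ->
  exists h : U -> option T,
  [/\ forall x, A x -> exists2 y, B y & h y = Some x,
      forall y x, h y = Some x -> A x &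
      forall y y' x, h y = Some x -> h y' = Some x -> y = y'].
Proof.
move=> /card_leP[f].
pose P x y := exists2 a : A, val a = x & val (f a) = y.
have /choice[h hP] : forall y, exists o : option T,
    (forall x, o = Some x -> P x y) /\ (forall x, P x y -> o = Some x).
  move=> y; have [[x Px]|nP] := pselect (exists x, P x y); last first.
    by exists None; split=> // x Px; case: nP; exists x.
  exists (Some x); split=> [_ [<-]//|x' Px']; congr Some.
  case: Px Px' => a <- fa [a' <- fa']; congr val.
  by apply: (@inj _ _ _ f); rewrite ?inE //; apply: val_inj; rewrite fa fa'.
exists h; split.
- move=> x Ax; pose a : A := SigSub (mem_set Ax).
  by exists (val (f a)); [exact: set_valP|apply: (hP _).2; exists a].
- by move=> y x /(hP _).1 [a <- _]; exact: set_valP.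
- move=> y y' x /(hP _).1 [a ax <-] /(hP _).1 [a' a'x <-].
  by have -> : a = a' by apply: val_inj; rewrite ax a'x.
Qed.

Lemma card_le_fun T U (A : set T) (B : set U) : U -> (A #<= B)%card ->
  exists2 f : T -> U, forall x, A x -> B (f x) &
    forall x y, A x -> A y -> f x = f y -> x = y.
Proof.
move=> u0 /card_leP[g].
pose f x := if pselect (A x) is left Ax then val (g (SigSub (mem_set Ax) : A)) else u0.
exists f => [x Ax|x y Ax Ay]; rewrite /f.
  by case: pselect => // ?; exact: set_valP.
case: pselect => // Ax'; case: pselect => // Ay' /val_inj.
by move=> /(@inj _ _ _ g); rewrite !inE => /(_ I I) [].
Qed.

(** Zorn's lemma on graphs of partial injections: a maximal one exhausts [A] or
    [B]. *)
Lemma card_le_total T U (A : set T) (B : set U) :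
  (A #<= B)%card \/ (B #<= A)%card.
Proof.
pose P (G : set (T * U)) := G `<=` A `*` B /\
  forall p q, G p -> G q -> (p.1 = q.1 <-> p.2 = q.2).
have [F FP totF|G [[GAB Ginj] Gmax]] := @Zorn_bigcup _ P.
  split=> [p [X FX Xp]|p q [X FX Xp] [Y FY Yq]]; first exact: (FP _ FX).1.
  have [XY|YX] := totF _ _ FX FY.
  - by apply: (FP _ FY).2 => //; exact: XY.
  - by apply: (FP _ FX).2 => //; exact: YX.
have [domG|/existsNP[x /not_implyP[Ax nGx]]] :=
    pselect (forall x, A x -> exists y, G (x, y)).
  left; apply: (@card_le_rel _ _ _ _ (fun x y => G (x, y))) => [x /domG[y Gxy]|].
    by exists y => //; exact: (GAB _ Gxy).2.
  by move=> x x' y _ _ Gx Gx'; exact: (Ginj _ _ Gx Gx').2.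
have [ranG|/existsNP[y /not_implyP[By nGy]]] :=
    pselect (forall y, B y -> exists x, G (x, y)).
  right; apply: (@card_le_rel _ _ _ _ (fun y x => G (x, y))) => [z /ranG[w Gwz]|].
    by exists w => //; exact: (GAB _ Gwz).1.
  by move=> z z' w _ _ Gz Gz'; exact: (Ginj _ _ Gz Gz').1.
have GxN z : ~ G (x, z) by move=> ?; apply: nGx; exists z.
have GyN z : ~ G (z, y) by move=> ?; apply: nGy; exists z.
case: (Gmax (G `|` [set (x, y)])).
  split; first exact: subsetUl.
  by move=> /(_ (x, y)) /(_ (or_intror erefl)); exact: GxN.
split=> [p [/GAB//|->//]|p q [Gp|->] [Gq|->]] //=; first exact: Ginj.
- by case: p Gp => a b Gab /=; split=> eab; subst; [case: (GxN b)|case: (GyN a)].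
- by case: q Gq => a b Gab /=; split=> eab; subst; [case: (GxN b)|case: (GyN a)].
Qed.

Lemma card_leW T U (A : set T) (B : set U) : (A #= B)%card -> (A #<= B)%card.
Proof. by rewrite card_eq_le => /andP[]. Qed.

Lemma card_geW T U (A : set T) (B : set U) : (A #= B)%card -> (B #<= A)%card.
Proof. by rewrite card_eq_le => /andP[]. Qed.

Lemma card_leNgt T U (A : set T) (B : set U) : ~ (A #< B)%card -> (B #<= A)%card.
Proof.
move=> nAB; have [AB|//] := card_le_total A B.
by have [/card_geW//|nE] := boolP (A #= B)%card; case: nAB.
Qed.

Lemma card_lt_geF T U (A : set T) (B : set U) : (A #< B)%card -> (B #<= A)%card -> False.
Proof. by move=> [AB /negP nAB] BA; apply: nAB; rewrite card_eq_le AB. Qed.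

Lemma card_le_lt_trans T U V (A : set T) (B : set U) (C : set V) :
  (A #<= B)%card -> (B #< C)%card -> (A #< C)%card.
Proof.
move=> AB BC; split; first exact: card_le_trans AB BC.1.
apply/negP => AC; apply: (card_lt_geF BC); apply: card_le_trans AB.
exact: card_geW.
Qed.

Lemma card_lt_le_trans T U V (A : set T) (B : set U) (C : set V) :
  (A #< B)%card -> (B #<= C)%card -> (A #< C)%card.
Proof.
move=> AB BC; split; first exact: card_le_trans AB.1 BC.
apply/negP => AC; apply: (card_lt_geF AB); apply: (card_le_trans BC).
exact: card_geW.
Qed.

(** Zorn's lemma in the form that cuts a set into countable pieces. *)
Lemma maximal_disjoint_sequences N T (n0 : N) (S : set (N -> T)) :
  exists D : set (N -> T), [/\ D `<=` S,
    forall s t i j, D s -> D t -> s i = t j -> s = t &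
    forall s, S s -> exists i t j, D t /\ s i = t j].
Proof.
have [D [DS Ddis Dmax]] := ex_maximal_disjoint_subcollection (fun s : N -> T => range s) S.
exists D; split=> // [s t i j Ds Dt sitj|s Ss].
  by apply: (Ddis s t Ds Dt); exists (s i); split; [exists i|exists j].
have [Ds|nDs] := pselect (D s); first by exists n0, s, n0.
apply: contrapT => nex; apply: (Dmax (D `|` [set s])).
- by split; [exact: subsetUl|move=> /(_ s (or_intror erefl))].
- by move=> _ [/DS//|->].
have dis u i j : D u -> s i <> u j by move=> Du siuj; apply: nex; exists i, u, j.
move=> u v [Du|->] [Dv|->] [x [[i _ <-] [j _ e]]] //.
- by apply: (Ddis u v Du Dv); exists (u i); split; [exists i|exists j].
- by case: (dis u j i Du e).
- by case: (dis v i j Dv (esym e)).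
Qed.

Lemma infinite_sequence T (A : set T) : infinite_set A ->
  exists2 s : nat -> T, injective s & forall n, A (s n).
Proof.
move=> infA; have [x0 _] := infinite_setN0 infA.
move/infiniteP: infA => /(card_le_fun x0)[s sA sinj].
by exists s => [m n /sinj|n]; [apply|exact: sA].
Qed.

Lemma countable_rank T (A : set T) : countable A ->
  exists r : T -> nat, forall x y, A x -> A y -> r x = r y -> x = y.
Proof. by move=> /(card_le_fun 0)[r _ rinj]; exists r. Qed.

(** A maximal family [D] of disjoint injective sequences covers [A] up to a
    countable rest, so [A] is essentially [D * nat], which absorbs a factor
    [nat]. *)
Lemma card_le_setX_nat T (A : set T) : infinite_set A ->
  (A `*` [set: nat] #<= A)%card.
Proof.
move=> infA.
pose S := [set s : nat -> T | injective s /\ forall n, A (s n)].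
have [D [DS Ddis Dmax]] := maximal_disjoint_sequences 0 S.
pose U := [set x | exists2 s, D s & exists n, s n = x].
have UA : U `<=` A by move=> _ [s /DS[_ sA] [n <-]].
have cC : countable (A `\` U).
  apply: finite_set_countable; apply: contrapT => infC.
  have [s sinj sC] := infinite_sequence infC.
  have [|i [t [j [Dt sitj]]]] := Dmax s; first by split=> // n; have [] := sC n.
  by have [_] := sC i; apply; exists t => //; exists j.
have [s0 Ds0] : D !=set0.
  have [s sinj sA] := infinite_sequence infA.
  by have [//|_ [t [_ [Dt _]]]] := Dmax s; exists t.
have [r rinj] := countable_rank cC.
(* the tags 0 and 1 keep the codes of the covered part of [A] and those of the
   countable rest, which is stored along the sequence [s0], apart *)
pose G (p : T * nat) (x : T) := exists s k, D s /\
  ((s k = p.1 /\ x = s (pickle (0, k, p.2))) \/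
  [/\ s = s0, ~ (U p.1) & x = s0 (pickle (1, r p.1, p.2))]).
apply: (@card_le_rel _ _ _ _ G).
  move=> [a n] [/= Aa _]; have [[s Ds [k ska]]|nUa] := pselect (U a).
    exists (s (pickle (0, k, n))); first by have [_ ] := DS _ Ds; apply.
    by exists s, k; split => //; left.
  exists (s0 (pickle (1, r a, n))); first by have [_ ] := DS _ Ds0; apply.
  by exists s0, 0; split=> //; right.
move=> [a n] [b m] x [/= Aa _] [/= Ab _] [s [k [Ds sP]]] [t [l [Dt tP]]].
have [sinj _] := DS _ Ds.
have est p q : x = s p -> x = t q -> s = t /\ p = q.
  move=> -> e; have st := Ddis _ _ _ _ Ds Dt e.
  by split=> //; apply: sinj; rewrite e -st.
case: sP => [[/= <- xs]|[ss0 nUa /= xs]]; case: tP => [[/= <- xt]|[tt0 nUb /= xt]].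
- by have [-> /(pcan_inj pickleK)[-> ->]] := est _ _ xs xt.
- by rewrite -tt0 in xt; have [_ /(pcan_inj pickleK)] := est _ _ xs xt.
- by rewrite -ss0 in xs; have [_ /(pcan_inj pickleK)] := est _ _ xs xt.
- rewrite -ss0 in xs; rewrite -tt0 in xt.
  have [_ /(pcan_inj pickleK)[rab ->]] := est _ _ xs xt.
  by rewrite (rinj a b).
Qed.

Lemma card_le_bigcup_countable I T (D : set I) (F : I -> set T) :
  infinite_set D -> (forall i, D i -> countable (F i)) ->
  (\bigcup_(i in D) F i #<= D)%card.
Proof.
move=> infD cF; apply: card_le_trans (card_le_setX_nat infD).
have /choice[r rP] : forall i, exists r : T -> nat,
    D i -> forall x y, F i x -> F i y -> r x = r y -> x = y.
  move=> i; have [/cF/countable_rank[r rP]|] := pselect (D i); first by exists r.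
  by exists (fun=> 0).
apply: (@card_le_rel _ _ _ _ (fun x p => [/\ D p.1, F p.1 x & r p.1 x = p.2])).
  by move=> x [i Di Fix]; exists (i, r i x).
by move=> x y [i n] _ _ /= [Di Fx rx] [_ Fy ry]; apply: (rP _ Di); rewrite ?rx.
Qed.

Lemma finite_or_card_gt T n (A : set T) : (A #<= `I_n)%card \/ (`I_n.+1 #<= A)%card.
Proof.
have [A1|] := card_le_total A `I_n.+1; last by right.
have /finite_setP[k Ak] : finite_set A.
  by apply/finite_set_leP; exists n.+1.
have := leq_total k n; rewrite (card_le_eql Ak) (card_le_eqr Ak) !card_le_II.
by case: (leqP k n) => kn _; [left|right].
Qed.

(** For finite [B] one more element than [B] has would already appear in a single
    [S n]; for infinite [B] the union is a countable union of sets at most as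
    large as [B]. *)
Lemma card_le_bigcup_nondecreasing T U (S : nat -> set T) (B : set U) :
  (forall m n, (m <= n)%N -> S m `<=` S n) -> (forall n, (S n #<= B)%card) ->
  (\bigcup_n S n #<= B)%card.
Proof.
move=> Smono SB; have [/finite_setP[n Bn]|infB] := pselect (finite_set B).
  have [|] := finite_or_card_gt n (\bigcup_n S n); first by rewrite (card_le_eqr Bn).
  move=> /[dup] + nS; have [[x0 _]|S0] := pselect ((\bigcup_n S n) !=set0); last first.
    by move: S0 => /set0P/negP; rewrite negbK => /eqP ->; rewrite card_ge0.
  move=> /(card_le_fun x0)[f fS finj].
  have /choice[m mP] : forall i, exists m, (i < n.+1)%N -> S m (f i).
    move=> i; case: (ltnP i n.+1) => [/fS[m _ Sm]|_]; first by exists m.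
    by exists 0.
  pose M := \max_(i < n.+1) m i.
  have : (`I_n.+1 #<= S M)%card.
    apply: (@card_le_inj _ _ _ _ f) => // i ilt.
    by apply: (Smono (m i)); [exact: (leq_bigmax (Ordinal ilt))|exact: mP].
  move=> /card_le_trans/(_ (SB M)); rewrite (card_le_eqr Bn) card_le_II.
  by rewrite ltnn.
apply: card_le_trans (card_le_setX_nat infB).
have [[x0 _]|S0] := pselect ((\bigcup_n S n) !=set0); last first.
  by move: S0 => /set0P/negP; rewrite negbK => /eqP ->; rewrite card_ge0.
have [u0 _] := infinite_setN0 infB.
have /choice[f fP] : forall n, exists f : T -> U, (forall x, S n x -> B (f x)) /\
    forall x y, S n x -> S n y -> f x = f y -> x = y.
  by move=> n; have [f ? ?] := card_le_fun u0 (SB n); exists f.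
apply: (@card_le_rel _ _ _ _ (fun x p => S p.2 x /\ f p.2 x = p.1)).
  move=> x [n _ Sx]; exists (f n x, n) => //.
  by split=> //=; apply: (fP n).1.
move=> x y [u n] _ _ /= [Sx fx] [Sy fy].
by apply: ((fP n).2 _ _ Sx Sy); rewrite fx.
Qed.

(** A maximal family of disjoint sequences with growing levels leaves a rest of
    bounded level. By hypothesis the covered part, which contains some tail, is as
    large as [E]; hence the rest can be distributed among the sequences, one
    element in front of each, where no level is prescribed. *)
Lemma partition_sequences T (E : set T) (lev : T -> nat) (g : nat -> nat) :
  (forall n, (E #<= E `&` [set x | (n < lev x)%N])%card) ->
  exists (I : Type) (s : I -> nat -> T),
  [/\ forall i k, E (s i k),
      forall i j k l, s i k = s j l -> i = j /\ k = l,
      forall x, E x -> exists i k, s i k = x &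
      forall i k, (0 < k)%N -> (g k <= lev (s i k))%N].
Proof.
move=> Elev.
(* each member of the family is a double sequence, that is, countably many
   sequences, so that there are as many sequences as covered elements; the two
   bounds serve a sequence kept as it is and one shifted by a new first element *)
pose S := [set s : nat * nat -> T | injective s /\
  forall p, [/\ E (s p), (g p.2 <= lev (s p))%N & (g p.2.+1 <= lev (s p))%N]].
have [D [DS Ddis Dmax]] := maximal_disjoint_sequences (0, 0) S.
pose U := [set x | exists2 s, D s & exists p, s p = x].
have [n nP] : exists n, forall x, E x -> ~ U x -> (lev x <= n)%N.
  apply: contrapT => nex.
  have /choice[pick pickP] : forall n, exists x, [/\ E x, ~ U x & (n < lev x)%N].
    move=> n; apply: contrapT => nex'; apply: nex; exists n => x Ex nUx.
    by rewrite leqNgt; apply/negP => nlev; apply: nex'; exists x.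
  (* an uncovered sequence with increasing levels, indexed through the coding of
     pairs, contradicts maximality *)
  pose h m := if (unpickle m : option (nat * nat)) is Some p then maxn (g p.2) (g p.2.+1) else 0.
  pose fix t m := if m is m'.+1 then pick (maxn (lev (t m')) (h m)) else pick (h 0).
  have tE m : E (t m) by case: m => [|m] /=; set n := (X in pick X); case: (pickP n).
  have tU m : ~ U (t m) by case: m => [|m] /=; set n := (X in pick X); case: (pickP n).
  have th m : (h m <= lev (t m))%N.
    case: m => [|m]; first by case: (pickP (h 0)) => _ _ /ltnW.
    case: (pickP (maxn (lev (t m)) (h m.+1))) => _ _ /ltnW; rewrite geq_max => /andP[_].
    exact.
  have tlt m : (lev (t m) < lev (t m.+1))%N.
    by case: (pickP (maxn (lev (t m)) (h m.+1))) => _ _; rewrite gtn_max => /andP[].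
  have tmono m m' : (m < m')%N -> (lev (t m) < lev (t m'))%N.
    elim: m' => // m' IH; rewrite ltnS leq_eqVlt => /predU1P[->//|/IH/ltn_trans]; exact.
  have tinj : injective t.
    move=> m m' e; case: (ltngtP m m') => // /tmono; by rewrite e ltnn.
  have [|p [s [q [Ds]]]] := Dmax (fun p => t (pickle p)).
    split=> [p q /tinj/(pcan_inj pickleK)//|p].
    have := th (pickle p); rewrite /h pickleK geq_max => /andP[? ?].
    by split.
  by move=> tpsq; apply: (tU (pickle p)); exists s => //; exists q.
pose I := (@sigT (nat * nat -> T) D * nat)%type.
have UI : (U #<= [set: I])%card.
  apply: (@card_le_rel _ _ _ _ (fun x (i : I) =>
    exists p, projT1 i.1 p = x /\ i.2 = pickle p)).
    by move=> _ [s Ds [p <-]]; exists (existT D s Ds, pickle p) => //; exists p.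
  by move=> x y i _ _ [p [<- ip]] [q [<-]]; rewrite ip => /(pcan_inj pickleK) ->.
have /card_le_pinv[inv [invP inv_in inv_inj]] : (E `\` U #<= [set: I])%card.
  apply: card_le_trans UI; apply: (@card_le_trans _ _ _ E).
    by apply: subset_card_le => x [].
  apply: (card_le_trans (Elev n)); apply: subset_card_le => x [Ex /= nx].
  by apply: contrapT => /(nP _ Ex); rewrite leqNgt nx.
pose s (i : I) k := if inv i is Some c then
  (if k is k'.+1 then projT1 i.1 (i.2, k') else c) else projT1 i.1 (i.2, k).
have iS (i : I) := DS _ (projT2 i.1).
have UD (i : I) p : U (projT1 i.1 p) by exists (projT1 i.1); [exact: projT2|exists p].
have same_term (i j : I) p q : projT1 i.1 p = projT1 j.1 q -> i.1 = j.1 /\ p = q.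
  case: i j => [[u Du] a] [[v Dv] b] /= e.
  have uv := Ddis _ _ _ _ Du Dv e; subst v.
  by split; [rewrite (Prop_irrelevance Du Dv)|apply: (DS _ Du).1].
have fresh (i j : I) c p : inv i = Some c -> c <> projT1 j.1 p.
  by move=> /inv_in[_ nUc] e; apply: nUc; rewrite e; exact: UD.
exists I, s; split.
- move=> i k; rewrite /s; case e: (inv i) => [c|]; last by case: ((iS i).2 (i.2, k)).
  by case: k => [|k]; [case: (inv_in _ _ e)|case: ((iS i).2 (i.2, k))].
- move=> i j k l; rewrite /s.
  have pairE (i' j' : I) : i'.1 = j'.1 -> i'.2 = j'.2 -> i' = j'.
    by case: i' j' => [? ?] [? ?] /= -> ->.
  case ei: (inv i) => [c|]; case ej: (inv j) => [d|].
  + case: k l => [|k] [|l].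
    * by move=> cd; subst d; split => //; apply: inv_inj ei ej.
    * by move=> /(fresh _ _ _ _ ei).
    * by move=> /esym/(fresh _ _ _ _ ej).
    * by move=> /same_term[ij1 [ij2 ->]]; split=> //; exact: pairE.
  + case: k => [|k]; first by move=> /(fresh _ _ _ _ ei).
    move=> /same_term[ij1 [ij2 _]]; have ij := pairE _ _ ij1 ij2.
    by rewrite ij ej in ei.
  + case: l => [|l]; first by move=> /esym/(fresh _ _ _ _ ej).
    move=> /same_term[ij1 [ij2 _]]; have ij := pairE _ _ ij1 ij2.
    by rewrite ij ej in ei.
  + by move=> /same_term[ij1 [ij2 ->]]; split=> //; exact: pairE.
- move=> x Ex; have [[u Du [[a b] <-]]|nUx] := pselect (U x).
    pose i : I := (existT D u Du, a); exists i.
    case e: (inv i) => [c|]; first by exists b.+1; rewrite /s e.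
    by exists b; rewrite /s e.
  by have [//|i _ inv_i] := invP x; exists i, 0; rewrite /s inv_i.
- move=> i k k0; rewrite /s; case e: (inv i) => [c|]; last by case: ((iS i).2 (i.2, k)).
  by case: k k0 => // k _; case: ((iS i).2 (i.2, k)).
Qed.

Local Open Scope ring_scope.

(** * Inner product and norm *)

Section inner_product.
Context {R : realType} {H : hilbertType R}.
Implicit Types (x y z : H) (a : R[i]).

Lemma hdotDl x y z : hdot (x + y) z = hdot x z + hdot y z.
Proof. exact: linearDl. Qed.
Lemma hdotDr x y z : hdot x (y + z) = hdot x y + hdot x z.
Proof. exact: linearDr. Qed.
Lemma hdotBl x y z : hdot (x - y) z = hdot x z - hdot y z.
Proof. exact: linearBl. Qed.
Lemma hdotBr x y z : hdot x (y - z) = hdot x y - hdot x z.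
Proof. exact: linearBr. Qed.
Lemma hdotZl a x y : hdot (a *: x) y = a * hdot x y.
Proof. exact: linearZl_LR. Qed.
Lemma hdotZr a x y : hdot x (a *: y) = Num.conj a * hdot x y.
Proof. exact: linearZr_LR. Qed.
Lemma hdotC x y : hdot x y = Num.conj (hdot y x).
Proof. by rewrite (@hermC _ _ _ _ (@hdot R H)) /= mul1r. Qed.
Lemma hdot0l y : hdot 0 y = 0 :> R[i].
Proof. exact: linear0l. Qed.
Lemma hdot0r y : hdot y 0 = 0 :> R[i].
Proof. exact: linear0r. Qed.
Lemma hdot_suml I r (P : pred I) (F : I -> H) y :
  hdot (\sum_(i <- r | P i) F i) y = \sum_(i <- r | P i) hdot (F i) y.
Proof. exact: linear_sumlz. Qed.
Lemma hdot_sumr I r (P : pred I) (F : I -> H) y :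
  hdot y (\sum_(i <- r | P i) F i) = \sum_(i <- r | P i) hdot y (F i).
Proof. exact: linear_sumr. Qed.
Lemma hdot_eq0C x y : hdot x y = 0 -> hdot y x = 0.
Proof. by rewrite (hdotC y) => ->; rewrite rmorph0. Qed.

Lemma normrE x : `|x| = (hnorm x)%:C%C.
Proof. by rewrite /hnorm RRe_real ?normr_real. Qed.
Lemma hnorm_ge0 x : 0 <= hnorm x.
Proof. by rewrite -ler0c -normrE. Qed.
Lemma hnorm_eq0 x : hnorm x = 0 -> x = 0.
Proof. by move=> e; apply/eqP; rewrite -normr_eq0 normrE e. Qed.
Lemma hnorm0 : hnorm (0 : H) = 0.
Proof. by rewrite /hnorm normr0. Qed.
Lemma hnorm_gt0 x : x != 0 -> 0 < hnorm x.
Proof.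
move=> x0; rewrite lt_neqAle hnorm_ge0 andbT eq_sym.
by apply: contra_neq x0; exact: hnorm_eq0.
Qed.
Lemma ler_hnormD x y : hnorm (x + y) <= hnorm x + hnorm y.
Proof. by rewrite -lecR rmorphD /= -!normrE ler_normD. Qed.
Lemma hnormN x : hnorm (- x) = hnorm x.
Proof. by rewrite /hnorm normrN. Qed.
Lemma hnorm_distC x y : hnorm (x - y) = hnorm (y - x).
Proof. by rewrite -hnormN opprB. Qed.
Lemma normcE a : `|a| = (normc a)%:C%C.
Proof. by case: a. Qed.
Lemma hnormZ a x : hnorm (a *: x) = normc a * hnorm x.
Proof. by apply: complexI; rewrite rmorphM /= -!normrE normrZ normcE. Qed.
Lemma hnorm_sqr x : ((hnorm x) ^+ 2)%:C%C = hdot x x.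
Proof. by rewrite -hdot_norm normrE rmorphXn. Qed.
Lemma hdot_eq0 x : hdot x x = 0 -> x = 0.
Proof. by rewrite -hdot_norm => /eqP; rewrite expf_eq0 normr_eq0 => /eqP. Qed.
Lemma normc_ge0 a : 0 <= normc a.
Proof. by rewrite -ler0c -normcE. Qed.
Lemma normc_conjM a b : normc (Num.conj a * b) = normc a * normc b.
Proof. by apply: complexI; rewrite rmorphM /= -!normcE normrM norm_conjC. Qed.
Lemma normc_real (r : R) : 0 <= r -> normc r%:C%C = r.
Proof. by move=> r0; apply: complexI; rewrite -normcE ger0_norm // ler0c. Qed.
Lemma normc_hdotxx x : normc (hdot x x) = hnorm x ^+ 2.
Proof. by rewrite -hnorm_sqr normc_real ?sqr_ge0. Qed.
Lemma hnorm1 x : hdot x x = 1 -> hnorm x = 1.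
Proof.
move=> x1; have /eqP : hnorm x ^+ 2 = 1 by rewrite -normc_hdotxx x1 normc1.
by rewrite sqrp_eq1 ?hnorm_ge0 // => /eqP.
Qed.
Lemma hnorm_normalize x (r : R) : 0 <= r -> x != 0 ->
  hnorm ((r / hnorm x)%:C%C *: x) = r.
Proof.
move=> r0 x0; rewrite hnormZ normc_real ?divr_ge0 ?hnorm_ge0 //.
by rewrite divfK // gt_eqF ?hnorm_gt0.
Qed.

Lemma hnormD_orthogonal x y : hdot x y = 0 ->
  hnorm (x + y) ^+ 2 = hnorm x ^+ 2 + hnorm y ^+ 2.
Proof.
move=> xy; apply: complexI; rewrite rmorphD /= !hnorm_sqr hdotDl !hdotDr xy.
by rewrite (hdot_eq0C xy) addr0 add0r.
Qed.
Lemma parallelogram x y :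
  hnorm (x + y) ^+ 2 + hnorm (x - y) ^+ 2 = 2 * (hnorm x ^+ 2 + hnorm y ^+ 2).
Proof.
apply: complexI; rewrite rmorphM !rmorphD /= !hnorm_sqr.
by rewrite hdotBl !hdotBr hdotDl !hdotDr; ring.
Qed.

Lemma orthogonal_component x y : y != 0 -> exists a,
  hdot (x - a *: y) y = 0 /\ hnorm (a *: y) * hnorm y = normc (hdot x y).
Proof.
move=> y0; pose a := hdot x y / hdot y y; exists a.
have yy0 : hdot y y != 0 by apply: contra_neq y0; exact: hdot_eq0.
split; first by rewrite hdotBl hdotZl divfK // subrr.
rewrite hnormZ -mulrA -expr2 /a normcM -normc_hdotxx.
rewrite -mulrA normcV mulVf ?mulr1 //.
by apply: contra_neq yy0; exact: eq0_normc.
Qed.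

Lemma cauchy_schwarz x y : normc (hdot x y) <= hnorm x * hnorm y.
Proof.
have [->|y0] := eqVneq y 0; first by rewrite hdot0r hnorm0 mulr0 normc0.
have [a [ort <-]] := orthogonal_component x y0.
rewrite ler_pM2r ?hnorm_gt0 // -(@ler_pXn2r _ 2) ?nnegrE ?hnorm_ge0 //.
have -> : x = (x - a *: y) + a *: y by rewrite subrK.
by rewrite hnormD_orthogonal ?lerDr ?sqr_ge0 // hdotZr ort mulr0.
Qed.
End inner_product.

(** * Topology of a Hilbert space through the real-valued norm *)

Section hilbert_topology.
Context {R : realType} {H : hilbertType R}.
Implicit Types (x y z : H) (a : R[i]) (S : set H).

Lemma ball_hnorm x (e : R) y : ball x e%:C%C y = (hnorm (x - y) < e).
Proof. by rewrite -ball_normE /ball_ /= normrE ltcR. Qed.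

Lemma posC (e : R[i]) : 0 < e -> exists2 r : R, 0 < r & e = r%:C%C.
Proof.
move=> e0; exists (complex.Re e); first by rewrite -ltcR RRe_real ?gtr0_real.
by rewrite RRe_real ?gtr0_real.
Qed.

Lemma nbhs_hnormP x S :
  nbhs x S <-> exists2 e : R, 0 < e & forall y, hnorm (x - y) < e -> S y.
Proof.
split=> [/nbhs_ballP[e /posC[r r0 ->] rS]|[e e0 eS]].
  by exists r => // y xy; apply: rS; rewrite ball_hnorm.
apply/nbhs_ballP; exists e%:C%C => [|y]; rewrite /= ?ltcR // ball_hnorm.
exact: eS.
Qed.

Lemma cvg_hnormP (u : nat -> H) l :
  u @ \oo --> l <-> forall e : R, 0 < e ->
    exists N, forall n, (N <= n)%N -> hnorm (l - u n) < e.
Proof.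
split=> [ul e e0|ul].
  have /ul[N _ NP] : nbhs l [set y | hnorm (l - y) < e] by apply/nbhs_hnormP; exists e.
  by exists N => n; exact: NP.
move=> S /nbhs_hnormP[e e0 eS]; have [N NP] := ul _ e0.
by exists N => // n /NP; exact: eS.
Qed.

Lemma closure_hnormP S x :
  closure S x <-> forall e : R, 0 < e -> exists2 y, S y & hnorm (x - y) < e.
Proof.
split=> [cSx e e0|Sx B /nbhs_hnormP[e e0 eB]].
  have [|y [Sy xy]] := cSx [set y | hnorm (x - y) < e]; first by apply/nbhs_hnormP; exists e.
  by exists y.
by have [y Sy /eB By] := Sx _ e0; exists y.
Qed.

Lemma closed_hnormP S : closed S <->
  forall x, (forall e : R, 0 < e -> exists2 y, S y & hnorm (x - y) < e) -> S x.
Proof.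
split=> [cS x Sx|cS x /closure_hnormP]; last exact: cS.
by apply: cS; apply/closure_hnormP.
Qed.

Lemma dense_hnormP S : dense S <->
  forall x (e : R), 0 < e -> exists2 y, S y & hnorm (x - y) < e.
Proof.
split=> [dS x e e0|dS].
  have [||y [/= xy Sy]] := dS (ball x e%:C%C)°.
  - by exists x; apply: nbhsx_ballx; rewrite ltcR.
  - exact: open_interior.
  exists y => //; rewrite -ball_hnorm; exact: nbhs_singleton xy.
move=> O [x Ox] oO; have /nbhs_hnormP[e e0 eO] : nbhs x O by apply: open_nbhs_nbhs; split.
by have [y Sy /eO Oy] := dS x e e0; exists y.
Qed.

Lemma hilbert_complete (u : nat -> H) :
  (forall e : R, 0 < e -> exists N, forall m n, (N <= m)%N -> (N <= n)%N ->
    hnorm (u m - u n) < e) -> exists l : H, u @ \oo --> l.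
Proof.
move=> uC; apply/(@cvg_ex H)/(@cauchy_cvgP H)/cauchy_ballP => e /posC[r r0 ->].
have [N NP] := uC _ r0.
exists (u @` [set n | (N <= n)%N], u @` [set n | (N <= n)%N]) => /=.
  by split; exists N => // n /= Nn; exists n.
by move=> [_ _] /= [[m mN <-] [n nN <-]]; rewrite ball_hnorm; exact: NP.
Qed.

Lemma cvg_closed S (u : nat -> H) l : closed S -> (forall n, S (u n)) ->
  u @ \oo --> l -> S l.
Proof.
move=> /closed_hnormP cS Su /cvg_hnormP ul; apply: cS => e /ul[N NP].
by exists (u N) => //; exact: NP.
Qed.

Lemma le0_of_lt_pos (r M : R) : 0 <= M -> (forall e, 0 < e -> r <= M * e) -> r <= 0.
Proof.
move=> M0 rP; rewrite leNgt; apply/negP => r0.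
have M1 : 0 < M + 1 by rewrite ltr_wpDl.
set d := r / (M + 1) / 2; have d0 : 0 < d by rewrite !divr_gt0.
have rE : r = 2 * ((M + 1) * d) by rewrite /d; field; rewrite gt_eqF.
have := rP _ d0; have : 0 <= M * d by rewrite mulr_ge0 // ltW.
by move: rE; lra.
Qed.

Lemma eq0_normc_small (z : R[i]) (M : R) : 0 <= M ->
  (forall e : R, 0 < e -> normc z <= M * e) -> z = 0.
Proof.
move=> M0 zM; apply/eq0_normc/eqP; rewrite eq_le normc_ge0 andbT.
exact: le0_of_lt_pos zM.
Qed.

Lemma eq_limit_hdot (u : nat -> H) l y c N : u @ \oo --> l ->
  (forall n, (N <= n)%N -> hdot (u n) y = c) -> hdot l y = c.
Proof.
move=> /cvg_hnormP ul uc; apply/eqP; rewrite -subr_eq0; apply/eqP.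
apply: (@eq0_normc_small _ (hnorm y)) => [|e /ul[N' NP]]; first exact: hnorm_ge0.
pose n := maxn N N'; rewrite -(uc n) ?leq_maxl // -hdotBl.
apply: (le_trans (cauchy_schwarz _ _)); rewrite mulrC ler_wpM2l ?hnorm_ge0 ?ltW //.
by apply: NP; exact: leq_maxr.
Qed.

Lemma hdot_closure0 S y : (forall x, S x -> hdot x y = 0) ->
  forall x, closure S x -> hdot x y = 0.
Proof.
move=> Sy x /closure_hnormP cS.
apply: (@eq0_normc_small _ (hnorm y)) => [|e /cS[z Sz xz]]; first exact: hnorm_ge0.
rewrite -[hdot x y]subr0 -(Sy z Sz) -hdotBl.
by apply: (le_trans (cauchy_schwarz _ _)); rewrite mulrC ler_wpM2l ?hnorm_ge0 ?ltW.
Qed.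

End hilbert_topology.

(** * Subspaces, projections and orthonormal bases *)

Section subspaces.
Context {R : realType} {H : hilbertType R}.
Implicit Types (x y z : H) (a : R[i]) (S E F Z : set H).

Lemma linear_subspaceP S : linear_subspace S <->
  S 0 /\ forall a x y, S x -> S y -> S (a *: x + y).
Proof.
split=> [[S0 SP]|[S0 SP]]; split; rewrite ?inE // in S0 *.
  by move=> a x y /mem_set Sx /mem_set Sy; apply/set_mem/SP.
by move=> a x y; rewrite !inE; exact: SP.
Qed.

Lemma subspaceZ S a x : linear_subspace S -> S x -> S (a *: x).
Proof. by move=> /linear_subspaceP[S0 SP] Sx; rewrite -[_ *: _]addr0; exact: SP. Qed.

Lemma subspaceD S x y : linear_subspace S -> S x -> S y -> S (x + y).
Proof. by move=> /linear_subspaceP[S0 SP] Sx; rewrite -[x]scale1r; exact: SP. Qed.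

Lemma subspaceB S x y : linear_subspace S -> S x -> S y -> S (x - y).
Proof. by move=> lS Sx Sy; apply: subspaceD => //; rewrite -scaleN1r; exact: subspaceZ. Qed.

Lemma subspace0 S : linear_subspace S -> S 0.
Proof. by move=> /linear_subspaceP[]. Qed.

Lemma subspace_sum S (I : Type) (r : seq I) (P : pred I) (F : I -> H) :
  linear_subspace S -> (forall i, P i -> S (F i)) -> S (\sum_(i <- r | P i) F i).
Proof.
move=> lS SF; apply: (big_ind S) => //; first exact: subspace0.
by move=> x y; exact: subspaceD.
Qed.

Lemma orthocomplement_closed S : closed_subspace (orthocomplement S).
Proof.
split; first apply/linear_subspaceP; first split.
- by move=> y _; exact: hdot0l.
- by move=> a x y Sx Sy z Sz; rewrite hdotDl hdotZl Sx // Sy // mulr0 addr0.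
- by move=> x cx y Sy; apply: (hdot_closure0 _ cx) => z; apply.
Qed.

(** Moving [z] along [y] decreases the squared distance to [x] by [e ^+ 2] at most,
    and the optimal move decreases it by the square of
    [normc (hdot (x - z) y) / hnorm y]. *)
Lemma near_minimizer S x (D e : R) z y : linear_subspace S -> 0 <= e ->
  (forall u, S u -> D <= hnorm (x - u) ^+ 2) ->
  S z -> hnorm (x - z) ^+ 2 <= D + e ^+ 2 -> S y ->
  normc (hdot (x - z) y) <= e * hnorm y.
Proof.
move=> lS e0 DP Sz ze Sy.
have [->|y0] := eqVneq y 0; first by rewrite hdot0r normc0 hnorm0 mulr0.
have [a [ort <-]] := orthogonal_component (x - z) y0.
rewrite ler_wpM2r ?hnorm_ge0 // -(@ler_pXn2r _ 2) ?nnegrE ?hnorm_ge0 //.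
have : hnorm (x - z) ^+ 2 = hnorm (x - z - a *: y) ^+ 2 + hnorm (a *: y) ^+ 2.
  by rewrite -hnormD_orthogonal ?subrK // hdotZr ort mulr0.
have /DP : S (z + a *: y) by apply: subspaceD => //; exact: subspaceZ.
by rewrite opprD addrA; lra.
Qed.

Lemma exists_inv_lt (e : R) : 0 < e ->
  exists N, forall n, (N <= n)%N -> n.+1%:R^-1 < e.
Proof.
move=> e0; exists (Num.truncn e^-1) => n Nn.
rewrite invf_plt ?posrE // (lt_le_trans (truncnS_gt _)) // ler_nat ltnS //.
Qed.

(** A minimizing sequence for the distance from [x] to [S] is Cauchy by the
    parallelogram identity, applied to the midpoints, which stay in [S]. *)
Lemma projection S x : closed_subspace S ->
  exists2 z, S z & forall y, S y -> hdot (x - z) y = 0.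
Proof.
move=> [lS cS]; pose N := [set hnorm (x - u) ^+ 2 | u in S].
have iN : has_inf N.
  split; first by exists (hnorm (x - 0) ^+ 2); exists 0 => //; exact: subspace0.
  by exists 0 => _ [u _ <-]; exact: sqr_ge0.
pose D := inf N.
have DP u : S u -> D <= hnorm (x - u) ^+ 2 by move=> Su; apply: ge_inf; [case: iN|exists u].
have /choice[u uP] n : exists u, S u /\ hnorm (x - u) ^+ 2 <= D + (n.+1%:R^-1) ^+ 2.
  have [|_ [u Su <-] /ltW ?] := @inf_adherent _ N (n.+1%:R^-1 ^+ 2) _ iN; last by exists u.
  by rewrite exprn_gt0.
have uS n := (uP n).1; have uD n := (uP n).2.
have uC m n : hnorm (u m - u n) ^+ 2 <= 2 * (m.+1%:R^-1 ^+ 2 + n.+1%:R^-1 ^+ 2).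
  have := parallelogram (x - u m) (x - u n).
  have -> : x - u m - (x - u n) = - (u m - u n).
    by rewrite !opprB addrC subrKA.
  have -> : x - u m + (x - u n) = 2 *: (x - 2^-1 *: (u m + u n)).
    rewrite scalerBr scalerA mulfV ?pnatr_eq0 // scale1r opprD addrACA.
    by rewrite scaler_nat mulr2n.
  rewrite hnormN hnormZ.
  have -> : normc (2 : R[i]) = 2.
    by apply: complexI; rewrite -normcE normr_nat rmorph_nat.
  have /DP : S (2^-1 *: (u m + u n)) by apply: subspaceZ => //; exact: subspaceD.
  by have := uD m; have := uD n; rewrite exprMn; move: (m.+1%:R^-1) (n.+1%:R^-1) => p q; lra.
have [|z /[dup] uz /cvg_hnormP uzP] := @hilbert_complete R H u.
  move=> e e0; have [|M MP] := @exists_inv_lt (e / 2); first by rewrite divr_gt0.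
  exists M => m n Mm Mn; rewrite -(@ltr_pXn2r _ 2) ?nnegrE ?hnorm_ge0 ?ltW //.
  apply: (le_lt_trans (uC m n)).
  have := MP _ Mm; have := MP _ Mn.
  have : (0 : R) < m.+1%:R^-1 by rewrite invr_gt0.
  have : (0 : R) < n.+1%:R^-1 by rewrite invr_gt0.
  by move: (m.+1%:R^-1) (n.+1%:R^-1) => p q; nra.
exists z; first exact: (cvg_closed cS uS).
move=> y Sy.
apply: (@eq0_normc_small _ _ (2 * hnorm y)) => [|e e0]; first by rewrite mulr_ge0 ?hnorm_ge0.
have [M1 M1P] := uzP _ e0; have [M2 M2P] := exists_inv_lt e0.
pose n := maxn M1 M2; have := M1P n (leq_maxl _ _); have := M2P n (leq_maxr _ _).
have := near_minimizer lS _ DP (uS n) (uD n) Sy; rewrite invr_ge0 ler0n => /(_ isT).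
rewrite hnorm_distC => b1 b2 b3.
have -> : x - z = (x - u n) + (u n - z) by rewrite addrA subrK.
rewrite hdotDl; apply: (le_trans (le_normcD _ _)).
rewrite -mulrA [_ * e]mulrC mulr_natl mulr2n; apply: lerD.
  by apply: (le_trans b1); rewrite ler_wpM2r ?hnorm_ge0 // ltW.
by apply: (le_trans (cauchy_schwarz _ _)); rewrite ler_wpM2r ?hnorm_ge0 // ltW.
Qed.

Lemma orthocomplementK S : closed_subspace S ->
  orthocomplement (orthocomplement S) = S.
Proof.
move=> cS; apply/seteqP; split=> [x xP|x Sx y yP]; last exact/hdot_eq0C/yP.
have [z Sz zP] := projection x cS.
suff -> : x = z by [].
apply/eqP; rewrite -subr_eq0; apply/eqP/hdot_eq0; rewrite hdotBr (zP z Sz) subr0.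
by apply: hdot_eq0C; apply: xP.
Qed.

Lemma linear_span_subspace E : linear_subspace (linear_span E).
Proof.
apply/linear_subspaceP; split=> [S [lS _]|a x y xP yP S lES]; first exact: subspace0.
have [/linear_subspaceP[_ SP] _] := lES; exact: (SP a x y (xP S lES) (yP S lES)).
Qed.

Lemma sub_linear_span E : E `<=` linear_span E.
Proof. exact: sub_gen_smallest. Qed.

Lemma linear_span_sub E S : linear_subspace S -> E `<=` S -> linear_span E `<=` S.
Proof. by move=> lS ES x; apply. Qed.

Lemma closure_subspace S : linear_subspace S -> closed_subspace (closure S).
Proof.
move=> lS; split; last exact: closed_closure.
apply/linear_subspaceP; split; first by apply: subset_closure; exact: subspace0.
move=> a x y /closure_hnormP cx /closure_hnormP cy; apply/closure_hnormP => e e0.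
have M0 : 0 < 2 * (normc a + 1) by rewrite mulr_gt0 ?ltr_wpDl ?normc_ge0.
have [x' Sx' xx'] := cx (e / (2 * (normc a + 1))) (divr_gt0 e0 M0).
have [|y' Sy' yy'] := cy (e / 2); first by rewrite divr_gt0.
exists (a *: x' + y'); first by apply: subspaceD => //; exact: subspaceZ.
have -> : a *: x + y - (a *: x' + y') = a *: (x - x') + (y - y').
  by rewrite scalerBr opprD addrACA.
apply: (le_lt_trans (ler_hnormD _ _)); rewrite hnormZ.
have : normc a * hnorm (x - x') <= e / 2.
  apply: (@le_trans _ _ ((normc a + 1) * (e / (2 * (normc a + 1))))); last first.
    by rewrite le_eqVlt; apply/orP; left; apply/eqP; field; rewrite gt_eqF // ltr_wpDl ?normc_ge0.
  by rewrite ler_pM ?normc_ge0 ?hnorm_ge0 ?lerDl // ltW.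
by move: yy'; lra.
Qed.

Lemma orthonormal_neq0 E x : orthonormal_set E -> E x -> x != 0.
Proof.
move=> oE Ex; apply/eqP => x0; have := oE _ _ Ex Ex.
by rewrite x0 hdot0l eqxx => /eqP; rewrite eq_sym oner_eq0.
Qed.

Lemma orthonormal_hnorm E x : orthonormal_set E -> E x -> hnorm x = 1.
Proof. by move=> oE Ex; apply: hnorm1; rewrite oE // eqxx. Qed.

Lemma orthogonal_span E x : (forall e, E e -> hdot x e = 0) ->
  forall y, linear_span E y -> hdot x y = 0.
Proof.
move=> xE y yE; apply: hdot_eq0C.
have [lS _] := orthocomplement_closed [set x].
by apply: (linear_span_sub lS _ yE) => [e Ee _ ->|//]; exact/hdot_eq0C/xE.
Qed.

Lemma basis_closed_subspace Z E : orthonormal_basis Z E -> closed_subspace Z.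
Proof. by move=> [_ <-]; apply: closure_subspace; exact: linear_span_subspace. Qed.

Lemma basis_sub Z E : orthonormal_basis Z E -> E `<=` Z.
Proof. by move=> [_ <-] x Ex; apply: subset_closure; exact: sub_linear_span. Qed.

Lemma basis_span_sub Z E : orthonormal_basis Z E -> linear_span E `<=` Z.
Proof. by move=> [_ <-]; exact: subset_closure. Qed.

Lemma basis_orthogonal Z E x : orthonormal_basis Z E ->
  (forall e, E e -> hdot x e = 0) -> orthocomplement Z x.
Proof.
move=> [_ <-] xE y cy; apply: hdot_eq0C; apply: (hdot_closure0 _ cy) => z zE.
by apply: hdot_eq0C; exact: orthogonal_span zE.
Qed.

Lemma basis_eq0 Z E x : orthonormal_basis Z E -> Z x ->
  (forall e, E e -> hdot x e = 0) -> x = 0.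
Proof. by move=> bE Zx /(basis_orthogonal bE)/(_ x Zx); exact: hdot_eq0. Qed.

Lemma orthonormal_basisP Z E : closed_subspace Z -> orthonormal_set E -> E `<=` Z ->
  (forall x, Z x -> (forall e, E e -> hdot x e = 0) -> x = 0) ->
  orthonormal_basis Z E.
Proof.
move=> cZ oE EZ Z0; split=> //; have lspan := linear_span_subspace E.
apply/seteqP; split=> [x cx|x Zx].
  apply: (cZ.2); apply: closureS cx.
  exact: linear_span_sub cZ.1 EZ.
have [z cz zP] := projection x (closure_subspace lspan).
suff -> : x = z by [].
apply/eqP; rewrite -subr_eq0; apply/eqP/Z0.
  apply: (subspaceB cZ.1) => //; apply: (cZ.2); apply: closureS cz.
  exact: linear_span_sub cZ.1 EZ.
by move=> e Ee; apply: zP; apply: subset_closure; exact: sub_linear_span.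
Qed.

(** A maximal orthonormal set in [Z] is a basis of [Z]: otherwise a unit vector
    orthogonal to it could be added. *)
Lemma exists_orthonormal_basis Z : closed_subspace Z ->
  exists E, orthonormal_basis Z E.
Proof.
move=> cZ; pose P E := E `<=` Z /\ orthonormal_set E.
have [A AP totA|E [[EZ oE] Emax]] := @Zorn_bigcup _ P.
  split=> [x [E AE Ex]|x y [E AE Ex] [E' AE' E'y]]; first exact: (AP _ AE).1.
  have [EE'|E'E] := totA _ _ AE AE'.
  - by apply: (AP _ AE').2 => //; exact: EE'.
  - by apply: (AP _ AE).2 => //; exact: E'E.
exists E; apply: orthonormal_basisP => // x Zx xE; apply: contrapT => /eqP x0.
pose y := (1 / hnorm x)%:C%C *: x.
have yy : hdot y y = 1 by rewrite -hnorm_sqr hnorm_normalize ?expr1n.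
have yE e : E e -> hdot y e = 0 by move=> Ee; rewrite hdotZl xE ?mulr0.
have nEy : ~ E y by move=> /yE; rewrite yy => /eqP; rewrite oner_eq0.
apply: (Emax (E `|` [set y])).
  by split; [exact: subsetUl|move=> /(_ y (or_intror erefl))].
split=> [z [/EZ//|->]|u v [Eu|->] [Ev|->]]; first exact: subspaceZ cZ.1 Zx.
- exact: oE.
- by rewrite (hdot_eq0C (yE _ Eu)); case: eqVneq Eu => // ->.
- by rewrite yE //; case: eqVneq Ev => // <-.
- by rewrite yy eqxx.
Qed.

Lemma bessel (s : nat -> H) x n :
  (forall i j, hdot (s i) (s j) = (i == j)%:R) ->
  \sum_(i < n) normc (hdot x (s i)) ^+ 2 <= hnorm x ^+ 2.
Proof.
move=> os; pose p n := x - \sum_(i < n) hdot x (s i) *: s i.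
suff -> : \sum_(i < n) normc (hdot x (s i)) ^+ 2 = hnorm x ^+ 2 - hnorm (p n) ^+ 2.
  by rewrite gerBl sqr_ge0.
have s1 i : hnorm (s i) = 1 by apply: hnorm1; rewrite os eqxx.
have ps m i : (i < m)%N -> hdot (p m) (s i) = 0.
  move=> im; rewrite /p hdotBl hdot_suml (bigD1 (Ordinal im)) //= hdotZl os eqxx mulr1.
  rewrite big1 ?addr0 ?subrr // => j /negPf ji.
  by rewrite hdotZl os; rewrite -val_eqE /= in ji; rewrite ji mulr0.
elim: n => [|n IH]; first by rewrite big_ord0 /p big_ord0 subr0 subrr.
have pS : p n = p n.+1 + hdot x (s n) *: s n by rewrite /p big_ord_recr /= opprD addrA subrK.
rewrite big_ord_recr /= IH pS hnormD_orthogonal; last by rewrite hdotZr ps ?mulr0.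
by rewrite hnormZ s1 mulr1; lra.
Qed.

(** By Bessel's inequality only finitely many [e] have
    [normc (hdot x e) ^+ 2 > 1 / n.+1]. *)
Lemma countable_nonorthogonal E x : orthonormal_set E ->
  countable [set e | E e /\ hdot x e != 0].
Proof.
move=> oE.
pose A n := [set e | E e /\ n.+1%:R^-1 < normc (hdot x e) ^+ 2].
have -> : [set e | E e /\ hdot x e != 0] = \bigcup_n A n.
  apply/seteqP; split=> [e [Ee xe]|e [n _ [Ee xe]]]; last first.
    split=> //; apply: contraTneq xe => ->; rewrite normc0 expr0n /=.
    by rewrite -leNgt invr_ge0.
  have [|N NP] := @exists_inv_lt (normc (hdot x e) ^+ 2); last first.
    by exists N => //; split=> //; exact: NP.
  rewrite exprn_gt0 // lt_neqAle normc_ge0 andbT eq_sym.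
  by apply: contra_neq xe; exact: eq0_normc.
apply: bigcup_countable => // n _; apply: finite_set_countable; apply: contrapT => infA.
have [s sinj sA] := infinite_sequence infA.
have os i j : hdot (s i) (s j) = (i == j)%:R.
  by rewrite (oE _ _ (sA i).1 (sA j).1) (inj_eq sinj).
pose N := (Num.truncn (hnorm x ^+ 2 * n.+1%:R)).+1.
have := bessel x N os; apply/negP; rewrite -ltNge.
apply: (@lt_le_trans _ _ (\sum_(i < N) n.+1%:R^-1)).
  rewrite sumr_const card_ord -[_ *+ N]mulr_natl ltr_pdivlMr //.
  exact: truncnS_gt.
by apply: ler_sum => i _; apply: ltW; case: (sA i).
Qed.

(** With [k.+1] vectors of [E], the [k.+1] by [k] matrix of inner products has a
    nonzero row kernel, that is, a nonzero combination orthogonal to [F]. *)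
Lemma card_le_orthonormal_finite E F k : orthonormal_set E -> (F #<= `I_k)%card ->
  (forall x, linear_span E x -> (forall f, F f -> hdot x f = 0) -> x = 0) ->
  (E #<= `I_k)%card.
Proof.
move=> oE Fk EF; have [//|kE] := finite_or_card_gt k E; exfalso.
have [e eE einj] := card_le_fun (0 : H) kE.
have /card_le_pinv[h [hF _ _]] := Fk.
pose f (j : 'I_k) : H := if h j is Some y then y else 0.
pose A : 'M[R[i]]_(k.+1, k) := \matrix_(i, j) hdot (e i) (f j).
have : kermx A != 0.
  by rewrite kermx_eq0 /row_free neq_ltn (leq_ltn_trans (rank_leq_col A)).
move=> /rowV0Pn[u uA u0]; move/sub_kermxP: uA => uA.
pose x := \sum_(i < k.+1) u 0 i *: e i.
have x0 : x = 0.
  apply: EF.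
    have lE := linear_span_subspace E.
    apply: (subspace_sum _ lE) => i _; apply: (subspaceZ _ lE).
    by apply: sub_linear_span; apply: eE => /=; exact: ltn_ord.
  move=> y Fy; have [j jk hj] := hF _ Fy.
  have /matrixP/(_ 0 (Ordinal jk)) := uA; rewrite !mxE => <-.
  rewrite hdot_suml; apply: eq_bigr => i _.
  by rewrite hdotZl mxE /f /= hj.
case/eqP: u0; apply/rowP => i; rewrite mxE.
have := hdot0l (e i); rewrite -x0 hdot_suml (bigD1 i) //= hdotZl oE; last first.
- exact: eE (ltn_ord i).
- exact: eE (ltn_ord i).
rewrite eqxx mulr1 big1 ?addr0 // => j ji.
rewrite hdotZl oE; [|exact: eE (ltn_ord j)|exact: eE (ltn_ord i)].
case: eqVneq => [/einj eij|_]; last by rewrite mulr0.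
by case/eqP: ji; apply: val_inj; apply: eij; exact: ltn_ord.
Qed.

(** The comparison principle for dimensions. Its hypothesis says that the
    orthogonal projection onto the closed span of [F] is injective on the algebraic
    span of [E], which is what trivial intersections provide. *)
Lemma card_le_orthonormal E F : orthonormal_set E ->
  (forall x, linear_span E x -> (forall f, F f -> hdot x f = 0) -> x = 0) ->
  (E #<= F)%card.
Proof.
move=> oE EF; have [/finite_setP[k Fk]|infF] := pselect (finite_set F).
  rewrite (card_le_eqr Fk); apply: (card_le_orthonormal_finite oE _ EF).
  by rewrite (card_le_eql Fk).
apply: (@card_le_trans _ _ _ (\bigcup_(f in F) [set e | E e /\ hdot f e != 0])).
  apply: subset_card_le => e Ee; apply: contrapT => nex.
  have /negP := orthonormal_neq0 oE Ee; apply; apply/eqP; apply: EF.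
    exact: sub_linear_span.
  move=> f Ff; apply: hdot_eq0C; apply/eqP; apply: contrapT => /negP fe.
  by apply: nex; exists f.
by apply: card_le_bigcup_countable => // f _; exact: countable_nonorthogonal.
Qed.

Lemma basis_card_le Z E E' : orthonormal_basis Z E -> orthonormal_set E' ->
  E' `<=` Z -> (E' #<= E)%card.
Proof.
move=> bE oE' E'Z; apply: card_le_orthonormal => // x xE'.
by apply: (basis_eq0 bE); exact: linear_span_sub (basis_closed_subspace bE).1 E'Z _ xE'.
Qed.

Lemma basis_card_eq Z E E' : orthonormal_basis Z E -> orthonormal_basis Z E' ->
  (E #= E')%card.
Proof.
move=> bE bE'; rewrite card_eq_le.
by rewrite (basis_card_le bE' bE.1 (basis_sub bE)) (basis_card_le bE bE'.1 (basis_sub bE')).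
Qed.

End subspaces.

(** * Riesz representation *)

Section riesz.
Context {R : realType} {K H : hilbertType R}.

(** The vector [g] is the value at [y] of the adjoint of [T]; the functional
    [hdot (T _) y] is recovered from a vector [z] orthogonal to its kernel. *)
Lemma riesz (T : {linear K -> H}) (y : H) : bounded_operator T ->
  exists g : K, forall x, hdot (T x) y = hdot x g.
Proof.
move=> [M MP]; pose N := [set x | hdot (T x) y = 0].
have lN : closed_subspace N.
  split; first apply/linear_subspaceP; first split.
  - by rewrite /N /= linear0 hdot0l.
  - by move=> a u v; rewrite /N /= => uN vN; rewrite linearP hdotDl hdotZl uN vN mulr0 addr0.
  apply/closed_hnormP => x xN.
  apply: (@eq0_normc_small _ _ (`|M| * hnorm y)) => [|e /xN[z zN xz]].
    by rewrite mulr_ge0 ?hnorm_ge0.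
  rewrite -[hdot _ _]subr0 -{1}zN -hdotBl -linearB.
  apply: (le_trans (cauchy_schwarz _ _)); rewrite mulrAC ler_wpM2r ?hnorm_ge0 //.
  apply: (le_trans (MP _)); apply: (@le_trans _ _ (`|M| * hnorm (x - z))).
    by rewrite ler_wpM2r ?hnorm_ge0 // ler_norm.
  by rewrite ler_wpM2l // ltW.
have [NT|/existsNP[x0 nNx0]] := pselect (forall x, N x).
  by exists 0 => x; rewrite hdot0r; exact: NT.
have [p Np pP] := projection x0 lN; pose z := x0 - p.
have Tz : hdot (T z) y != 0.
  by rewrite linearB hdotBl Np subr0; apply/eqP.
have zz : hdot z z != 0.
  by apply: contra_neq Tz => /hdot_eq0 ->; rewrite linear0 hdot0l.
exists (Num.conj (hdot (T z) y / hdot z z) *: z) => x.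
have : hdot (x - (hdot (T x) y / hdot (T z) y) *: z) z = 0.
  apply: hdot_eq0C; apply: pP.
  by rewrite /N /= linearB linearZ hdotBl hdotZl divfK ?subrr.
rewrite hdotBl hdotZl => /eqP; rewrite subr_eq0 => /eqP xz.
rewrite hdotZr conjCK xz; field; exact/andP.
Qed.
End riesz.

(** * Sequences with geometrically decreasing steps *)

Section geometric_series.
Context {R : realType} {H : hilbertType R}.

Lemma exists_half_exp_lt (e : R) : 0 < e ->
  exists N, forall n, (N <= n)%N -> 2^-1 ^+ n < e.
Proof.
move=> e0; have [N NP] := exists_inv_lt e0; exists N => n Nn.
apply: le_lt_trans (NP _ Nn); rewrite exprVn lef_pV2 ?posrE ?exprn_gt0 //.
by rewrite -natrX ler_nat ltn_expl.
Qed.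

Lemma geometric_steps_le (u : nat -> H) (c : R) n : 0 <= c ->
  (forall k, hnorm (u (n + k).+1 - u (n + k)%N) <= c * 2^-1 ^+ k) ->
  forall k, hnorm (u (n + k)%N - u n) <= 2 * c.
Proof.
move=> c0 uc k; apply: (@le_trans _ _ (2 * c * (1 - 2^-1 ^+ k))); last first.
  by apply: ler_piMr; [rewrite mulr_ge0|rewrite gerBl exprn_ge0 ?invr_ge0].
elim: k => [|k IH]; first by rewrite addn0 subrr hnorm0 expr0 subrr mulr0.
have -> : u (n + k.+1)%N - u n = (u (n + k).+1 - u (n + k)%N) + (u (n + k)%N - u n).
  by rewrite addnS subrKA.
apply: (le_trans (ler_hnormD _ _)); apply: (le_trans (lerD (uc _) IH)).
rewrite exprS; set q := _ ^+ k.
by rewrite le_eqVlt; apply/orP; left; apply/eqP; field.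
Qed.

Lemma cvg_geometric_steps (u : nat -> H) (c : R) : 0 < c ->
  (forall n, hnorm (u n.+1 - u n) <= c * 2^-1 ^+ n) ->
  exists l : H, u @ \oo --> l.
Proof.
move=> c0 uc.
have uge n m : (n <= m)%N -> hnorm (u m - u n) <= 2 * (c * 2^-1 ^+ n).
  move=> /subnKC <-; apply: geometric_steps_le => [|k].
    by rewrite mulr_ge0 ?exprn_ge0 ?invr_ge0 // ltW.
  by rewrite -mulrA -exprD.
apply: hilbert_complete => e e0.
have [|N NP] := @exists_half_exp_lt (e / (4 * c)); first by rewrite divr_gt0 ?mulr_gt0.
exists N => m n Nm Nn; have := uge _ _ Nm; have := uge _ _ Nn.
have := NP N (leqnn N); rewrite ltr_pdivlMr ?mulr_gt0 // => lt1.
have -> : u m - u n = (u m - u N) - (u n - u N) by rewrite opprB subrKA.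
have := ler_hnormD (u m - u N) (- (u n - u N)); rewrite hnormN.
by move: lt1; move: (2^-1 ^+ N) => q; lra.
Qed.

Lemma geometric_tail_le (u : nat -> H) l (c : R) n : u @ \oo --> l -> 0 <= c ->
  (forall k, hnorm (u (n + k).+1 - u (n + k)%N) <= c * 2^-1 ^+ k) ->
  hnorm (l - u n) <= 2 * c.
Proof.
move=> /cvg_hnormP ul c0 uc; apply/ler_addgt0Pr => e /ul[N NP].
have := NP _ (leq_addl n N); have := geometric_steps_le c0 uc N.
have -> : l - u n = (u (n + N)%N - u n) + (l - u (n + N)%N) by rewrite [RHS]addrC addrA subrK.
have := ler_hnormD (u (n + N)%N - u n) (l - u (n + N)%N); lra.
Qed.

Lemma hnorm_lim_le (u : nat -> H) l (c : R) : u @ \oo --> l ->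
  (forall n, hnorm (u n) <= c) -> hnorm l <= c.
Proof.
move=> /cvg_hnormP ul uc; apply/ler_addgt0Pr => e /ul[N /(_ N (leqnn N)) le].
have -> : l = (l - u N) + u N by rewrite subrK.
by apply: (le_trans (ler_hnormD _ _)); rewrite [c + e]addrC; apply: lerD; [exact: ltW|exact: uc].
Qed.
End geometric_series.

(** * The range attached to a sequence of orthogonal subspaces *)

Section weighted_range.
Context {R : realType} {H : hilbertType R}.
Variables (H_ B : nat -> set H).
Hypothesis H_closed : forall n, (0 < n)%N -> closed_subspace (H_ n).
Hypothesis H_orthogonal : forall m n, (0 < m)%N -> (0 < n)%N -> m != n ->
  orthogonal_subspaces (H_ m) (H_ n).
Hypothesis B_basis : forall n, (0 < n)%N -> orthonormal_basis (H_ n) (B n).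

Definition weighted_range : set H := [set x | exists x_ : nat -> H,
  [/\ forall n, (0 < n)%N -> H_ n (x_ n),
      \sum_(1 <= n < N) x_ n @[N --> \oo] --> x &
      (\sum_(1 <= n <oo) ((2 ^+ n * hnorm (x_ n)) ^+ 2)%:E < +oo)%E]].

Definition tail_basis n := [set e | exists2 j, (n < j)%N & B j e].
Definition head_basis n := [set e | exists2 j, (0 < j <= n)%N & B j e].

Lemma hdot_partial_sum (x_ : nat -> H) N j y : (forall n, (0 < n)%N -> H_ n (x_ n)) ->
  (0 < j < N)%N -> H_ j y -> hdot (\sum_(1 <= n < N) x_ n) y = hdot (x_ j) y.
Proof.
move=> xH /andP[j0 jN] Hy; rewrite hdot_suml (bigD1_seq j) ?mem_index_iota ?j0 ?iota_uniq //=.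
rewrite big_seq_cond big1 ?addr0 // => i /andP[]; rewrite mem_index_iota => /andP[i0 _] ij.
by apply: (H_orthogonal _ _ ij) => //; exact: xH.
Qed.

Lemma hdot_component (x_ : nat -> H) x j y : (forall n, (0 < n)%N -> H_ n (x_ n)) ->
  \sum_(1 <= n < N) x_ n @[N --> \oo] --> x ->
  (0 < j)%N -> H_ j y -> hdot x y = hdot (x_ j) y.
Proof.
move=> xH xx j0 Hy; apply: (@eq_limit_hdot _ _ _ _ _ _ j.+1 xx) => n jn.
by apply: hdot_partial_sum => //; rewrite j0.
Qed.

(** The components of a vector of the range are bounded by a multiple of
    [2 ^- j]. Testing against all of the unit ball of [H_ j], instead of a basis,
    makes [C / 2 ^ j] bound the norm of the component. *)
Lemma weighted_range_bound x : weighted_range x ->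
  exists2 C : R, 0 <= C & forall j y, (0 < j)%N -> H_ j y -> hnorm y <= 1 ->
    2 ^+ j * normc (hdot x y) <= C.
Proof.
move=> [x_ [xH xx xs]]; set M := (\sum_(1 <= n <oo) _)%E in xs.
have u0 n : (0 <= ((2 ^+ n * hnorm (x_ n)) ^+ 2)%:E :> \bar R)%E by rewrite lee_fin sqr_ge0.
have M0 : (0 <= M)%E by apply: nneseries_ge0.
have Mfin : M \is a fin_num by rewrite ge0_fin_numE.
exists (fine M + 1) => [|j y j0 Hy y1]; first by rewrite addr_ge0 ?fine_ge0.
have jM : (2 ^+ j * hnorm (x_ j)) ^+ 2 <= fine M.
  rewrite -lee_fin fineK //.
  apply: (@le_trans _ _ (\sum_(1 <= n < j.+1) ((2 ^+ n * hnorm (x_ n)) ^+ 2)%:E)%E).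
    by rewrite big_nat_recr //= leeDr // sume_ge0.
  exact: nneseries_lim_ge.
rewrite (hdot_component xH xx j0 Hy).
have := cauchy_schwarz (x_ j) y; have := hnorm_ge0 (x_ j); have := hnorm_ge0 y.
have p0 : (0 : R) < 2 ^+ j by rewrite exprn_gt0.
move: (normc_ge0 (hdot (x_ j) y)) jM p0 y1.
move: (normc _) (hnorm (x_ j)) (hnorm y) (2 ^+ j) (fine M) => a b c p m a0 mb p0 c1 c0 b0 abc.
have pab : p * a <= p * b.
  by apply: ler_wpM2l; [exact: ltW|apply: (le_trans abc); exact: ler_piMr].
by apply: (le_trans pab); nra.
Qed.

Lemma weighted_range_finite (x_ : nat -> H) n : (forall j, (0 < j)%N -> H_ j (x_ j)) ->
  weighted_range (\sum_(1 <= j < n) x_ j).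
Proof.
move=> xH; pose z j := if (j < n)%N then x_ j else 0.
have zz N : (n <= N)%N -> \sum_(1 <= j < N) z j = \sum_(1 <= j < n) x_ j.
  move=> nN; have [n1|n0] := ltnP 0 n; last first.
    move: n0; rewrite leqn0 => /eqP n0; rewrite (@big_geq _ _ _ _ n) ?n0 // big1 // => j _.
    by rewrite /z n0.
  rewrite (@big_cat_nat _ _ _ n) //= [X in _ + X]big_nat_cond [X in _ + X]big1 ?addr0.
    by apply: eq_big_nat => j /andP[_ jn]; rewrite /z jn.
  by move=> j /andP[/andP[nj _] _]; rewrite /z ltnNge nj.
exists z; split.
- by move=> j j0; rewrite /z; case: ifP => _; [exact: xH|exact: subspace0 (H_closed j0).1].
- apply/cvg_hnormP => e e0; exists n => N /zz ->; by rewrite subrr hnorm0.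
- rewrite (@nneseries_split _ _ 1 n) => [|k _]; last by rewrite lee_fin sqr_ge0.
  rewrite eseries0 ?adde0 => [|k nk _]; last first.
    by rewrite /z ltnNge (leq_trans _ nk) ?add1n // hnorm0 mulr0 expr0n.
  by rewrite sumEFin ltry.
Qed.

Lemma sub_weighted_range n : (0 < n)%N -> H_ n `<=` weighted_range.
Proof.
move=> n0 x Hx; pose z j := if j == n then x else 0.
have -> : x = \sum_(1 <= j < n.+1) z j.
  rewrite big_nat_recr //= /z eqxx big_nat_cond big1 ?add0r // => j /andP[/andP[_ jn] _].
  by rewrite ltn_eqF.
apply: weighted_range_finite => j j0; rewrite /z; case: eqVneq => [->//|_].
exact: subspace0 (H_closed j0).1.
Qed.

Lemma basis_level_inj m n e : (0 < m)%N -> (0 < n)%N -> B m e -> B n e -> m = n.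
Proof.
move=> m0 n0 Bm Bn; apply/eqP; case: eqVneq => // mn.
have := H_orthogonal m0 n0 mn (basis_sub (B_basis m0) Bm) (basis_sub (B_basis n0) Bn).
move=> /hdot_eq0 e0; have := orthonormal_neq0 (B_basis m0).1 Bm.
by rewrite e0 eqxx.
Qed.

Lemma tail_basis_orthonormal n : orthonormal_set (tail_basis n).
Proof.
move=> x y [i ni Bx] [j nj By].
have i0 := leq_ltn_trans (leq0n _) ni; have j0 := leq_ltn_trans (leq0n _) nj.
have [ij|ij] := eqVneq i j; first by subst j; exact: (B_basis i0).1.
rewrite (H_orthogonal i0 j0 ij (basis_sub (B_basis i0) Bx) (basis_sub (B_basis j0) By)).
case: eqVneq => // xy; subst y.
by rewrite (basis_level_inj i0 j0 Bx By) eqxx in ij.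
Qed.

Lemma sub_tail_basis n : tail_basis n `<=` tail_basis 0.
Proof. by move=> x [j nj Bx]; exists j => //; exact: leq_ltn_trans nj. Qed.

Hypothesis range_dense : dense weighted_range.

Lemma total_basis_eq0 x : (forall e, tail_basis 0 e -> hdot x e = 0) -> x = 0.
Proof.
move=> xB; apply: hdot_eq0; apply: (@hdot_closure0 _ _ weighted_range); last first.
  by apply/closure_hnormP => e e0; move/dense_hnormP: range_dense; apply.
move=> y [y_ [yH yy _]]; apply: (@eq_limit_hdot _ _ _ _ _ _ 0 yy) => n _.
rewrite hdot_suml big_nat_cond big1 // => j /andP[/andP[j0 _] _].
apply: hdot_eq0C; apply: (basis_orthogonal (B_basis j0)); last exact: yH.
by move=> e Be; apply: xB; exists j.
Qed.

Lemma total_basis : orthonormal_basis [set: H] (tail_basis 0).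
Proof.
apply: orthonormal_basisP => // [|| x _]; last exact: total_basis_eq0.
- split; [by apply/linear_subspaceP|exact: closedT].
- exact: tail_basis_orthonormal.
Qed.

(** Such an [x] is the sum of its first [n] components, a finite sum. *)
Lemma orthogonal_tail_range n x : (forall e, tail_basis n e -> hdot x e = 0) ->
  weighted_range x.
Proof.
move=> xB.
have /choice[x_ xP] j : exists z, (0 < j)%N -> H_ j z /\ forall y, H_ j y -> hdot (x - z) y = 0.
  have [j0|_] := ltnP 0 j; last by exists 0.
  by have [z Hz zP] := projection x (H_closed j0); exists z.
have xH j : (0 < j)%N -> H_ j (x_ j) by move=> /xP[].
suff -> : x = \sum_(1 <= j < n.+1) x_ j by exact: weighted_range_finite.
apply/eqP; rewrite -subr_eq0; apply/eqP; apply: total_basis_eq0 => e [j j0 Be].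
have He := basis_sub (B_basis j0) Be.
rewrite hdotBl; have [jn|nj] := leqP j n.
  rewrite (hdot_partial_sum xH _ He) ?j0 ?ltnS // -hdotBl.
  by case: (xP j j0) => _; apply.
rewrite xB ?sub0r; last by exists j.
rewrite hdot_suml big_nat_cond big1 ?oppr0 // => i /andP[/andP[i0 iN] _].
apply: (H_orthogonal i0 j0) => //; last exact: xH.
by rewrite ltn_eqF // (leq_trans iN).
Qed.

(** A hump: if [K] has vectors of arbitrarily high levels, then it has small
    vectors with a huge weighted component. Indeed, components bounded by
    [M * 2 ^- j] for all [j > m] add up to a norm of at most [M * 2 ^- m], which is
    less than [d] for large [m]. *)
Lemma closed_subspace_range_large_component (K : set H) n (d M : R) :
  (forall n, exists2 w, K w & w != 0 /\ forall e, head_basis n e -> hdot w e = 0) ->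
  linear_subspace K -> K `<=` weighted_range -> 0 < d -> 0 < M ->
  exists v j y, [/\ K v, forall e, head_basis n e -> hdot v e = 0, hnorm v <= d,
    (n < j)%N & [/\ H_ j y, hnorm y <= 1 & M <= 2 ^+ j * normc (hdot v y)]].
Proof.
move=> Kn lK KR d0 M0; have [N NP] := @exists_half_exp_lt R (d / M) (divr_gt0 d0 M0).
pose m := maxn n N; have [w Kw [w0 wm]] := Kn m.
pose v := (d / hnorm w)%:C%C *: w.
have hv : hnorm v = d by rewrite hnorm_normalize // ltW.
have vm e : head_basis m e -> hdot v e = 0 by move=> /wm we; rewrite hdotZl we mulr0.
have Kv : K v by exact: subspaceZ.
exists v; apply: contrapT => nex.
have [v_ [vH vv _]] := KR _ Kv.
have vle j : (0 < j)%N -> hnorm (v_ j) <= if (m < j)%N then M * 2^-1 ^+ j else 0.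
  move=> j0; have vj := hdot_component vH vv j0; case: ltnP => [mj|jm]; last first.
    suff -> : v_ j = 0 by rewrite hnorm0.
    apply: (basis_eq0 (B_basis j0)) => [|e Be]; first exact: vH.
    rewrite -vj; last exact: basis_sub (B_basis j0) _ Be.
    by apply: vm; exists j => //; rewrite j0.
  rewrite exprVn ler_pdivlMr ?exprn_gt0 // leNgt; apply/negP => Mlt.
  have v0 : v_ j != 0 by apply: contraTneq Mlt => ->; rewrite hnorm0 mul0r -leNgt ltW.
  have hv0 := hnorm_gt0 v0.
  apply: nex; exists j, ((1 / hnorm (v_ j))%:C%C *: v_ j); split => //.
  - move=> e [i /andP[i0 ni] Be]; apply: vm; exists i => //.
    by rewrite i0 (leq_trans ni) // leq_maxl.
  - by rewrite hv.
  - by rewrite (leq_ltn_trans _ mj) // leq_maxl.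
  split.
  - exact: subspaceZ (H_closed j0).1 (vH _ j0).
  - by rewrite hnorm_normalize.
  - rewrite hdotZr vj; last exact: vH.
    rewrite normc_conjM normc_hdotxx normc_real ?divr_ge0 ?hnorm_ge0 // div1r.
    by rewrite expr2 mulKf ?gt_eqF // mulrC ltW.
have vsum k : hnorm (\sum_(1 <= j < k) v_ j) <= M * (2^-1 ^+ m - 2^-1 ^+ (maxn m k.-1)).
  elim: k => [|[|k] IH].
  - by rewrite big_geq // hnorm0 maxn0 subrr mulr0.
  - by rewrite big_geq // hnorm0 maxn0 subrr mulr0.
  - rewrite big_nat_recr //=; apply: (le_trans (ler_hnormD _ _)).
    apply: (le_trans (lerD IH (vle _ _))) => //=.
    case: ltnP => [mk|km]; last by rewrite (maxn_idPl (ltnW km)) addr0.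
    have [mk'|km] := leqP m k.
      by rewrite exprS; move: (2^-1 ^+ k) (2^-1 ^+ m) => p q; lra.
    by have := leq_trans mk km; rewrite ltnn.
have : hnorm v <= M * 2^-1 ^+ m.
  apply: (hnorm_lim_le vv) => k; apply: (le_trans (vsum k)).
  by rewrite ler_wpM2l ?ltW // ltrBlDr ltrDl exprn_gt0 // invr_gt0.
rewrite hv leNgt mulrC -ltr_pdivlMr // => /negP; apply; apply: NP; exact: leq_maxr.
Qed.

(** Gliding hump: otherwise, adding small humps of higher and higher levels gives a
    Cauchy sequence in [K] whose limit has unbounded weighted components, although
    the closed subspace [K] is contained in the range. *)
Lemma closed_subspace_range_head (K : set H) : closed_subspace K ->
  K `<=` weighted_range ->
  exists n, forall x, K x -> (forall e, head_basis n e -> hdot x e = 0) -> x = 0.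
Proof.
move=> [lK cK] KR; apply: contrapT => nex.
have Kn n : exists2 w, K w & w != 0 /\ forall e, head_basis n e -> hdot w e = 0.
  apply: contrapT => nex'; apply: nex; exists n => x Kx xn; apply: contrapT => /eqP x0.
  by apply: nex'; exists x.
(* from the vector [p.1] with humps of level at most [p.2], one passes to [q] by a
   step which leaves these levels untouched and makes a weighted component at
   level [q.2] at least [k.+1] *)
pose P k (p q : H * nat) := [/\ K q.1, (p.2 < q.2)%N, hnorm (q.1 - p.1) <= 2^-1 ^+ k,
  forall e, head_basis p.2 e -> hdot (q.1 - p.1) e = 0 &
  exists y, [/\ H_ q.2 y, hnorm y <= 1 & k.+1%:R <= 2 ^+ q.2 * normc (hdot q.1 y)]].
have /choice[f fP] (kp : nat * (H * nat)) : exists q, K kp.2.1 -> P kp.1 kp.2 q.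
  case: kp => k [x n] /=; have [Kx|] := pselect (K x); last by exists (x, n).
  have [||v [j [y [Kv vn vk nj [Hy y1 Mj]]]]] :=
    @closed_subspace_range_large_component K n (2^-1 ^+ k) (2 * k.+1%:R) Kn lK KR.
  - by rewrite exprn_gt0 // invr_gt0.
  - by rewrite mulr_gt0.
  (* if the component of [x] is not large, then that of [x + v] is, since the one
     of [v] is twice as large as needed *)
  have [xy|xy] := leP (k.+1%:R) (2 ^+ j * normc (hdot x y)).
    exists (x, j) => _; split=> //=.
    + by rewrite subrr hnorm0 exprn_ge0 // invr_ge0.
    + by move=> e _; rewrite subrr hdot0l.
    + by exists y.
  exists (x + v, j) => _; split=> //=.
  + exact: subspaceD.
  + by rewrite addrAC subrr add0r.
  + by move=> e en; rewrite addrAC subrr add0r; exact: vn.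
  + exists y; split=> //; have -> : hdot (x + v) y = hdot v y - - hdot x y.
      by rewrite opprK hdotDl addrC.
    have := le_normcD (hdot (x + v) y) (- hdot x y); rewrite normcN hdotDl addrAC subrr add0r.
    rewrite opprK [hdot v y + _]addrC => tri.
    have p0 : (0 : R) < 2 ^+ j by rewrite exprn_gt0.
    move: xy Mj tri; move: (normc _) (normc _) (normc _) (2 ^+ j) p0 => a b c p p0.
    by nra.
pose s := fix s k := if k is k'.+1 then f (k', s k') else (0, 0%N).
have sK k : K (s k).1.
  elim: k => [|k IH] /=; first exact: subspace0.
  by have [] := fP (k, s k) IH.
have sP k : P k (s k) (s k.+1) := fP (k, s k) (sK k).
have [|x sx] := @cvg_geometric_steps _ _ (fun k => (s k).1) 1 ltr01.
  by move=> k; rewrite mul1r; case: (sP k).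
have Kx : K x by apply: (cvg_closed cK sK sx).
have [C C0 CP] := weighted_range_bound (KR _ Kx).
have smono k l : (k <= l)%N -> ((s k).2 <= (s l).2)%N.
  elim: l => [|l IH]; first by rewrite leqn0 => /eqP ->.
  rewrite leq_eqVlt => /predU1P[->//|/IH kl]; apply: (leq_trans kl).
  by case: (sP l) => _ /ltnW.
pose k := Num.truncn C; have [_ skS _ _ [y [Hy y1 yk]]] := sP k.
have s0 : (0 < (s k.+1).2)%N by exact: leq_ltn_trans skS.
have := CP _ _ s0 Hy y1; apply/negP; rewrite -ltNge.
apply: (lt_le_trans (truncnS_gt C)).
suff -> : hdot x y = hdot (s k.+1).1 y by [].
apply: (@eq_limit_hdot _ _ _ _ _ _ k.+1 sx) => n.
elim: n => // n IH; rewrite leq_eqVlt => /predU1P[[->]//|kn].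
rewrite -(IH kn); apply/eqP; rewrite -subr_eq0 -hdotBl; apply/eqP.
apply: (basis_orthogonal (B_basis s0)) Hy => e Be.
by case: (sP n) => _ _ _ + _; apply; exists (s k.+1).2 => //; rewrite s0 smono.
Qed.

End weighted_range.

(** * Complementary subspaces that avoid superexponential decay *)

Section vandermonde_complements.
Context {R : realType} {H : hilbertType R} {I : Type}.
Variables (p : I -> bool -> nat -> H) (Rg : set H).
Hypothesis p_normed : forall i b k, hdot (p i b k) (p i b k) = 1.
Hypothesis p_orthogonal : forall i b k j c l,
  (i, b, k) <> (j, c, l) -> hdot (p i b k) (p j c l) = 0.
Hypothesis p_total : forall x, (forall i b k, hdot x (p i b k) = 0) -> x = 0.
Hypothesis Rg0 : Rg 0.
Hypothesis Rg_decay : forall x, Rg x -> exists2 C : R, 0 <= C &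
  forall i b k, (0 < k)%N -> 2 ^+ (k.+1 ^ 2) * normc (hdot x (p i b k)) <= C.

Let q n : R[i] := (2^-1 ^+ n)%:C%C.

Let conj_q n : Num.conj (q n) = q n.
Proof. by apply: conj_Creal; apply/complex_realP; exists (2^-1 ^+ n). Qed.

Let normc_q n : normc (q n) = 2^-1 ^+ n.
Proof. by rewrite normc_real // exprn_ge0 ?invr_ge0. Qed.

(** [t i b j] is the [j]-th row of the matrix [2 ^ - (j + 1)(k + 1)], in the
    coordinates [p i b k]; the matrix is symmetric, so the rows are also the
    columns. *)
Let t_sum i b j n := \sum_(k < n) q (j.+1 * k.+1) *: p i b k.

Let hnorm_t_step i b j n : hnorm (t_sum i b j n.+1 - t_sum i b j n) = 2^-1 ^+ (j.+1 * n.+1).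
Proof.
rewrite /t_sum big_ord_recr /= addrAC subrr add0r hnormZ normc_q.
by rewrite (hnorm1 (p_normed i b n)) mulr1.
Qed.

Let half_exp_le m n : (m <= n)%N -> (2^-1 : R) ^+ n <= 2^-1 ^+ m.
Proof. by move=> mn; apply: ler_wiXn2l => //; rewrite ?invr_ge0 // invf_le1 // ler1n. Qed.

Let exists_t ibj : exists l : H, t_sum ibj.1.1 ibj.1.2 ibj.2 n @[n --> \oo] --> l.
Proof.
apply: (@cvg_geometric_steps _ _ _ 1) => // n.
rewrite hnorm_t_step mul1r; apply: half_exp_le.
by rewrite mulSn (leq_trans (leqnSn n)) // leq_addr.
Qed.

Let t i b j := sval (cid (exists_t (i, b, j))).

Let t_cvg i b j : t_sum i b j n @[n --> \oo] --> t i b j.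
Proof. exact: (svalP (cid (exists_t (i, b, j)))). Qed.

Let hdot_t_p i b j c l : hdot (t i b j) (p i c l) = if b == c then q (j.+1 * l.+1) else 0.
Proof.
apply: (@eq_limit_hdot _ _ _ _ _ _ l.+1 (@t_cvg i b j)) => n ln.
rewrite /t_sum hdot_suml (bigD1 (Ordinal ln)) //= big1 => [|k kl].
  rewrite addr0 hdotZl; case: eqVneq => [->|bc]; first by rewrite p_normed mulr1.
  by rewrite p_orthogonal ?mulr0 // => -[/eqP]; rewrite (negPf bc).
by rewrite hdotZl p_orthogonal ?mulr0 // => -[_ kl']; case/eqP: kl; apply: val_inj.
Qed.

Let hdot_t_p_neq i b j i' c l : i <> i' -> hdot (t i b j) (p i' c l) = 0.
Proof.
move=> ii'; apply: (@eq_limit_hdot _ _ _ _ _ _ 0 (@t_cvg i b j)) => n _.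
by rewrite hdot_suml big1 // => k _; rewrite hdotZl p_orthogonal ?mulr0 // => -[].
Qed.

Let hdot_t_eq0 x i b j : (forall k, hdot x (p i b k) = 0) -> hdot x (t i b j) = 0.
Proof.
move=> xp; apply: hdot_eq0C; apply: (@eq_limit_hdot _ _ _ _ _ _ 0 (@t_cvg i b j)) => n _.
by rewrite hdot_suml big1 // => k _; rewrite hdotZl (hdot_eq0C (xp k)) mulr0.
Qed.

(** If [k] is the first index at which [x] has a nonzero coordinate, then
    [hdot x (t i b j)] is equivalent to [2 ^ - (j + 1)(k + 1)] times this coordinate
    as [j] grows, which is larger than any multiple of [2 ^ - (j + 1) ^ 2]. *)
Lemma superexponential_decay_eq0 x i b (C : R) : 0 <= C ->
  (forall j, (0 < j)%N -> 2 ^+ (j.+1 ^ 2) * normc (hdot x (t i b j)) <= C) ->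
  forall k, hdot x (p i b k) = 0.
Proof.
move=> C0 xC; elim/ltn_ind => k IH; apply: eq0_normc.
apply/eqP; rewrite eq_le normc_ge0 andbT.
apply: (@le0_of_lt_pos _ _ (C + 2 * hnorm x)) => [|e /exists_half_exp_lt[N NP]].
  by rewrite addr_ge0 ?mulr_ge0 ?hnorm_ge0.
pose j := maxn N k.+1; pose a := j.+1.
have qe : 2^-1 ^+ a < e by apply: NP; apply: leqW; exact: leq_maxl.
have ka : (k.+2 <= a)%N by rewrite ltnS leq_maxr.
apply: (@le_trans _ _ ((C + 2 * hnorm x) * 2^-1 ^+ a)); last first.
  by rewrite ler_wpM2l ?addr_ge0 ?mulr_ge0 ?hnorm_ge0 // ltW.
have tail : hnorm (t i b j - t_sum i b j k.+1) <= 2 * 2^-1 ^+ (a * k.+2).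
  apply: (geometric_tail_le (@t_cvg i b j)) => [|r]; first by rewrite exprn_ge0 ?invr_ge0.
  rewrite hnorm_t_step -exprD half_exp_le // -/a -addSn mulnDr leq_add2l.
  by rewrite mulSn leq_addr.
have head : hdot x (t_sum i b j k.+1) = q (a * k.+1) * hdot x (p i b k).
  rewrite /t_sum hdot_sumr big_ord_recr /= big1 ?add0r => [|l _].
    by rewrite hdotZr conj_q.
  by rewrite hdotZr IH ?mulr0.
have split_t : q (a * k.+1) * hdot x (p i b k) =
    hdot x (t i b j) + - hdot x (t i b j - t_sum i b j k.+1).
  by rewrite hdotBr head opprB addrC subrK.
have : 2^-1 ^+ (a * k.+1) * normc (hdot x (p i b k)) <=
    C * 2^-1 ^+ (a ^ 2) + hnorm x * (2 * 2^-1 ^+ (a * k.+2)).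
  have -> : 2^-1 ^+ (a * k.+1) * normc (hdot x (p i b k)) =
      normc (q (a * k.+1) * hdot x (p i b k)).
    by rewrite -[q _]conj_q normc_conjM normc_q.
  rewrite split_t; apply: (le_trans (le_normcD _ _)); apply: lerD.
    rewrite exprVn ler_pdivlMr ?exprn_gt0 // mulrC; apply: xC.
    by rewrite /j (leq_trans _ (leq_maxr _ _)).
  rewrite normcN; apply: (le_trans (cauchy_schwarz _ _)).
  by rewrite ler_wpM2l ?hnorm_ge0.
have aa : (2^-1 : R) ^+ (a ^ 2) <= 2^-1 ^+ a * 2^-1 ^+ (a * k.+1).
  rewrite -exprD half_exp_le // expnS expn1 -mulnS leq_mul2l ka orbT //.
have -> : (2^-1 : R) ^+ (a * k.+2) = 2^-1 ^+ a * 2^-1 ^+ (a * k.+1).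
  by rewrite -exprD -mulnS.
have : C * 2^-1 ^+ (a ^ 2) <= C * (2^-1 ^+ a * 2^-1 ^+ (a * k.+1)) by rewrite ler_wpM2l.
have : (0 : R) < 2^-1 ^+ (a * k.+1) by rewrite exprn_gt0 // invr_gt0.
move: (2^-1 ^+ (a ^ 2)) (2^-1 ^+ (a * k.+1)) (2^-1 ^+ a) (normc _) (hnorm x).
move=> r s u v w s0 h1 h2; rewrite -(@ler_pM2l _ s) //.
by apply: (le_trans h2); lra.
Qed.

(** If the coordinates of [x] along [b] are, up to sign, the image under the matrix
    of those along [c], then their decay makes both vanish. *)
Let coupled_eq0 x i b c : Rg x ->
  (forall k, normc (hdot x (p i b k)) = normc (hdot x (t i c k))) ->
  forall k, hdot x (p i c k) = 0 /\ hdot x (p i b k) = 0.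
Proof.
move=> /Rg_decay[C C0 CP] bc k.
have x0 : forall k, hdot x (p i c k) = 0.
  by apply: (superexponential_decay_eq0 C0) => j j0; rewrite -bc; exact: CP.
by split=> //; apply: eq0_normc; rewrite bc hdot_t_eq0 // normc0.
Qed.

(** [W] consists of the graphs, for each [i], of the matrix from the coordinates
    [false] to the coordinates [true]. It is defined by its equations, the
    orthogonality to the [p i true j - t i false j]; the vectors
    [p i false k + t i true k], which belong to it, give the equations of its
    orthogonal complement. *)
Lemma exists_vandermonde_complements : exists W : set H, [/\ closed_subspace W,
  W `&` Rg = [set 0] & orthocomplement W `&` Rg = [set 0]].
Proof.
pose N : set H := [set x | exists i j, x = p i true j - t i false j].
pose W := orthocomplement N; exists W.
have Wclosed : closed_subspace W := orthocomplement_closed N.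
have Wm i k : W (p i false k + t i true k).
  move=> _ [i' [j ->]]; rewrite hdotDl !hdotBr.
  rewrite p_orthogonal ?sub0r; last by case.
  have -> : hdot (t i true k) (t i' false j) = 0.
    apply: hdot_t_eq0 => l; have [<-|ii'] := pselect (i = i'); first by rewrite hdot_t_p.
    exact: hdot_t_p_neq.
  rewrite subr0 (hdotC (p i false k)).
  have [<-|ii'] := pselect (i = i'); last first.
    by rewrite !hdot_t_p_neq ?rmorph0 ?oppr0 ?addr0 // => ?; exact: ii'.
  by rewrite !hdot_t_p /= conj_q mulnC addNr.
have W0 := subspace0 Wclosed.1.
have W'0 := subspace0 (orthocomplement_closed W).1.
split=> //; apply/seteqP; split=> [x [Wx Rx]|_ ->] //; apply: p_total => i b k.
  have [k'|xt xf] := @coupled_eq0 x i true false Rx _ k; last by case: b.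
  have /eqP := Wx _ (ex_intro _ i (ex_intro _ k' erefl)).
  by rewrite hdotBr subr_eq0 => /eqP ->.
have [k'|xt xf] := @coupled_eq0 x i false true Rx _ k; last by case: b.
have /eqP := Wx _ (Wm i k').
by rewrite hdotDr addr_eq0 => /eqP ->; rewrite normcN.
Qed.
End vandermonde_complements.

(** * Reflections *)

Section reflection.
Context {R : realType} {H : hilbertType R}.

(** The operator [2 P - 1], with [P] the orthogonal projection onto [W]. The last
    part, for [x] and [U x] both in a subspace that meets [W] and its complement
    trivially, forces [x = 0]. *)
Lemma exists_reflection (W : set H) : closed_subspace W ->
  exists U : {linear H -> H}, unitary_operator U /\
    forall x, W (x + U x) /\ orthocomplement W (x - U x).
Proof.
move=> cW; have lW := cW.1; have [lW' _] := orthocomplement_closed W.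
have /choice[P PP] x : exists z, W z /\ orthocomplement W (x - z).
  by have [z Wz zP] := projection x cW; exists z; split.
have Puniq x z : W z -> orthocomplement W (x - z) -> P x = z.
  move=> Wz z'; have [Wp p'] := PP x; apply/eqP; rewrite -subr_eq0; apply/eqP/hdot_eq0.
  have -> : hdot (P x - z) (P x - z) = hdot ((x - z) - (x - P x)) (P x - z).
    by congr (hdot _ _); rewrite opprB [RHS]addrC subrKA.
  by rewrite hdotBl z' ?p' ?subrr //; exact: subspaceB.
have PD a x y : P (a *: x + y) = a *: P x + P y.
  have [? ?] := PP x; have [? ?] := PP y.
  apply: Puniq; first by apply: subspaceD => //; exact: subspaceZ.
  have -> : a *: x + y - (a *: P x + P y) = a *: (x - P x) + (y - P y).
    by rewrite scalerBr opprD addrACA.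
  by apply: (subspaceD lW') => //; exact: (subspaceZ _ lW').
pose U0 x := P x + P x - x.
have lU : linear U0.
  move=> a x y; rewrite /U0 PD scalerBr scalerDr opprD.
  by rewrite [RHS]addrACA [X in X + _ = _]addrACA.
pose U : {linear H -> H} := HB.pack U0 (GRing.isLinear.Build _ _ _ _ U0 lU).
have UE x : U x = P x - (x - P x) by rewrite /U /= /U0 opprB addrA.
have xE x : x = P x + (x - P x) by rewrite addrC subrK.
exists U; split; first split.
- move=> x y; change (hdot (U x) (U y) = hdot x y); rewrite !UE.
  have [Wx x'] := PP x; have [Wy y'] := PP y.
  rewrite {4}(xE x) {4}(xE y); move: (P x) (P y) (x - P x) (y - P y) Wx Wy x' y'.
  move=> u v u' v' Wu Wv u'W v'W.
  rewrite hdotBl !hdotBr hdotDl !hdotDr (u'W v Wv) (hdot_eq0C (v'W u Wu)).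
  by rewrite sub0r subr0 opprK addr0 add0r.
- apply/seteqP; split=> // y _; exists (U y) => //.
  have UW : P (U y) = P y.
    have [Wy y'] := PP y; apply: Puniq => //.
    by rewrite UE addrAC subrr; exact: (subspaceB lW' (subspace0 lW') y').
  by rewrite UE UW UE [X in _ - X]addrAC subrr sub0r opprK -xE.
- move=> x; have [Wx x'] := PP x; split.
    have -> : x + U x = P x + P x by rewrite UE opprB addrCA [x + _]addrC subrK.
    exact: subspaceD.
  have -> : x - U x = (x - P x) + (x - P x) by rewrite UE opprB addrCA.
  exact: (subspaceD lW').
Qed.
End reflection.

(** * Full tails *)

Section tails.
Context {R : realType} {H : hilbertType R}.
Variables (H_ B : nat -> set H).
Hypothesis H_closed : forall n, (0 < n)%N -> closed_subspace (H_ n).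
Hypothesis H_orthogonal : forall m n, (0 < m)%N -> (0 < n)%N -> m != n ->
  orthogonal_subspaces (H_ m) (H_ n).
Hypothesis B_basis : forall n, (0 < n)%N -> orthonormal_basis (H_ n) (B n).
Hypothesis range_dense : dense (weighted_range H_).

Local Notation Rg := (weighted_range H_).
Local Notation E := (tail_basis B 0).
Local Notation F := (tail_basis B).

Definition full_tails := forall n, (E #<= F n)%card.

Let E_basis : orthonormal_basis [set: H] E := total_basis H_orthogonal B_basis range_dense.

Let F_orthonormal n : orthonormal_set (F n) :=
  @tail_basis_orthonormal _ _ _ _ H_orthogonal B_basis n.

(** This turns a trivial intersection with [Rg] into a lower bound for [F n]. *)
Let F_range n x : (forall e, F n e -> hdot x e = 0) -> Rg x.
Proof. exact: orthogonal_tail_range. Qed.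

(** If the tail [F n] were smaller than [E], it would be smaller than a basis of
    some [Y] that meets [Rg] trivially; but the vectors of [Y] orthogonal to [F n]
    lie in [Rg]. *)
Lemma large_subspace_full_tails :
  (forall beta : Type, ([set: beta] #< E)%card -> exists Y : set H,
     [/\ closed_subspace Y, Y `&` Rg = [set 0] & dim_gt Y [set: beta]]) ->
  full_tails.
Proof.
move=> YP n; apply: card_leNgt => FE.
have [|Y [_ YR [G bG FG]]] := YP (set_type (F n)).
  exact: card_le_lt_trans (card_leW (card_setT _)) FE.
apply: (card_lt_geF FG); apply: card_le_trans (card_geW (card_setT _)).
apply: card_le_orthonormal bG.1 _ => x xG xF.
have : (Y `&` Rg) x by split; [exact: basis_span_sub xG|exact: F_range xF].
by rewrite YR.
Qed.

(** For large [n] the only vector of [K] that is a combination of [F n] is 0. *)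
Lemma full_tails_orthocomplement K : full_tails -> linear_subspace K -> K `<=` Rg ->
  closed K -> has_dim (orthocomplement K) E.
Proof.
move=> full lK KR cK.
have [n nP] := closed_subspace_range_head H_closed H_orthogonal B_basis (conj lK cK) KR.
have [G bG] := exists_orthonormal_basis (orthocomplement_closed K).
exists G => //; rewrite card_eq_le; apply/andP; split.
  exact: (basis_card_le E_basis bG.1).
apply: (card_le_trans (full n)); apply: card_le_orthonormal => [|x xF xG].
  exact: F_orthonormal.
apply: nP.
  by rewrite -(orthocomplementK (conj lK cK)); exact: basis_orthogonal xG.
move=> e [i /andP[i0 iN] Bi]; apply: hdot_eq0C; apply: orthogonal_span xF => f [j nj Bj].
have j0 := leq_ltn_trans (leq0n _) nj.
apply: (H_orthogonal i0 j0); first by rewrite ltn_eqF // (leq_ltn_trans iN).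
  exact: basis_sub (B_basis i0) _ Bi.
exact: basis_sub (B_basis j0) _ Bj.
Qed.

(** The vectors orthogonal to [F n] form a closed subspace contained in [Rg]; its
    orthogonal complement is the closed span of [F n]. *)
Lemma orthocomplement_full_tails :
  (forall K, linear_subspace K -> K `<=` Rg -> closed K -> has_dim (orthocomplement K) E) ->
  full_tails.
Proof.
move=> KP n; have [lM cM] := orthocomplement_closed (F n).
have [G bG GE] := KP _ lM (fun x xF => F_range xF) cM.
rewrite -(card_le_eql GE); apply: card_le_orthonormal bG.1 _ => x xG xF.
have xM := basis_span_sub bG xG.
exact/hdot_eq0/xM.
Qed.

(** With [g f] the value at [f] of the adjoint of [S], a vector [x] orthogonal to
    all [S (g f)] has [S (g x)] orthogonal to [F n], hence in both ranges, hence
    zero; so [x] is orthogonal to the dense range of [S]. *)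
Lemma disjoint_range_full_tails Rg' : operator_range Rg' -> dense Rg' ->
  Rg' `&` Rg = [set 0] -> full_tails.
Proof.
move=> [K [S [bS RS]]] dR' R'R n.
have /choice[g gP] y := riesz y bS.
apply: card_le_trans (card_image_le (fun f => S (g f)) (F n)).
apply: card_le_orthonormal E_basis.1 _ => x _ xF.
have Sgx0 : S (g x) = 0.
  have : (Rg' `&` Rg) (S (g x)); last by rewrite R'R.
  split; first by rewrite RS; exists (g x).
  apply: (@F_range n) => f Ff; rewrite gP; apply: hdot_eq0C; rewrite -gP.
  by apply: hdot_eq0C; apply: xF; exists f.
have gx0 : g x = 0 by apply: hdot_eq0; rewrite -gP Sgx0 hdot0l.
apply: hdot_eq0; apply: (@hdot_closure0 _ _ Rg').
  by rewrite RS => _ [y _ <-]; rewrite gP gx0 hdot0r.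
by apply/closure_hnormP => e e0; move/dense_hnormP: dR'; apply.
Qed.

(** Each sequence of the partition of [E] is split into its even and odd terms,
    which play the roles of source and target of the matrix. *)
Lemma full_tails_complements : full_tails -> exists W : set H, [/\ closed_subspace W,
  W `&` Rg = [set 0] & orthocomplement W `&` Rg = [set 0]].
Proof.
move=> full.
have /choice[lev levP] e : exists j, E e -> (0 < j)%N /\ B j e.
  have [[j j0 Be]|nE] := pselect (E e); first by exists j.
  by exists 0%N.
have [|I [s [sE sinj ssurj sg]]] := @partition_sequences _ E lev (fun k => k.+1 ^ 2)%N.
  move=> n; apply: (card_le_trans (full n)); apply: subset_card_le => e Fe.
  have Ee := sub_tail_basis Fe; split=> //=; have [l0 Bl] := levP _ Ee.
  case: Fe => j nj Bj.
  by rewrite (basis_level_inj H_orthogonal B_basis l0 (leq_ltn_trans (leq0n _) nj) Bl Bj).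
pose p i (b : bool) k := s i (b + k.*2)%N.
have sdot i k j l : hdot (s i k) (s j l) = (s i k == s j l)%:R by exact: E_basis.1.
apply: (@exists_vandermonde_complements _ _ I p Rg).
- by move=> i b k; rewrite sdot eqxx.
- move=> i b k j c l ne; rewrite sdot; case: eqVneq => // /sinj[ij bk]; case: ne.
  rewrite ij; have bc : b = c by have := congr1 odd bk; rewrite !oddD !odd_double !addbF !oddb.
  by move: bk; rewrite bc => /addnI/double_inj ->.
- move=> x xp; apply: (basis_eq0 E_basis) => // e /ssurj[i [k <-]].
  by have := xp i (odd k) k./2; rewrite /p odd_double_half.
- by apply: (@F_range 0) => e _; rewrite hdot0l.
- move=> x /(weighted_range_bound H_orthogonal)[C C0 CP]; exists C => // i b k k0.
  have [l0 Bl] := levP _ (sE i (b + k.*2)%N).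
  apply: (le_trans _ (CP _ _ l0 (basis_sub (B_basis l0) Bl) _)); last first.
    by rewrite (orthonormal_hnorm E_basis.1).
  rewrite ler_wpM2r ?normc_ge0 // ler_weXn2l ?ler1n //.
  apply: leq_trans (sg i (b + k.*2)%N _); last by rewrite addn_gt0 double_gt0 k0 orbT.
  rewrite leq_sqr ltnS -addnn addnA; exact: leq_addl.
Qed.

(** The span of [E] lies in [Rg], so none of its nonzero vectors is orthogonal to
    a basis of [W]. *)
Lemma complement_dim W : linear_subspace Rg -> closed_subspace W ->
  orthocomplement W `&` Rg = [set 0] -> has_dim W E.
Proof.
move=> lR cW W'R; have [G bG] := exists_orthonormal_basis cW.
exists G => //; rewrite card_eq_le (basis_card_le E_basis bG.1) //=.
apply: card_le_orthonormal E_basis.1 _ => x xE xG.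
have : (orthocomplement W `&` Rg) x; last by rewrite W'R.
split; first exact: basis_orthogonal xG.
apply: (linear_span_sub lR _ xE) => e [j j0 Be].
by apply: (sub_weighted_range H_closed j0); exact: basis_sub (B_basis j0) _ Be.
Qed.

(** The tail [F n] is the increasing union of the stretches of levels from [n.+1] to
    [m]. A cardinal that bounds all of them bounds their union, whether it is finite
    or infinite. *)
Lemma full_tailsP (A_ : nat -> Type) :
  (forall n, (0 < n)%N -> (B n #= [set: A_ n])%card) ->
  full_tails <->
  forall beta : Type, ([set: beta] #< E)%card -> forall n, (0 < n)%N ->
    exists2 m, (n < m)%N &
      ([set: beta] #< [set p : {j : nat & A_ j} | (n < tag p <= m)%N])%card.
Proof.
move=> BA.
pose Mid n m := [set e | exists2 j, (n < j <= m)%N & B j e].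
have BM n m : (Mid n m #= [set p : {j : nat & A_ j} | (n < tag p <= m)%N])%card.
  rewrite card_eq_le; apply/andP; split.
    have /choice[h hP] (j : nat) : exists h : {p : nat & A_ p} -> option H, (0 < j)%N ->
        forall e, B j e -> exists2 a : A_ j, True & h (existT _ j a) = Some e.
      have [j0|_] := ltnP 0 j; last by exists (fun=> None).
      have : (B j #<= [set: A_ j])%card by exact: card_leW (BA _ j0).
      move=> /card_le_pinv[h [hP _ _]].
      exists (fun p => if pselect (tag p = j) is left e
        then h (eq_rect _ A_ (tagged p) _ e) else None).
      move=> _ e /hP[a _ ha]; exists a => //=; case: pselect => // e'.
      by rewrite (Prop_irrelevance e' (erefl j)).
    apply: (@card_le_rel _ _ _ _ (fun e p => h (tag p) p = Some e)).
      move=> e [j /andP[nj jm] Be]; have j0 := leq_ltn_trans (leq0n _) nj.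
      by have [a _ ha] := hP j j0 e Be; exists (existT _ j a) => //=; rewrite nj.
    by move=> e e' p _ _ -> [].
  have /choice[h hP] (j : nat) : exists h : H -> option {p : nat & A_ p}, (0 < j)%N ->
      forall a : A_ j, exists2 e, B j e & h e = Some (existT _ j a).
    have [j0|_] := ltnP 0 j; last by exists (fun=> None).
    have : ([set: A_ j] #<= B j)%card by exact: card_geW (BA _ j0).
    move=> /card_le_pinv[h [hP _ _]].
    exists (fun e => if h e is Some a then Some (existT _ j a) else None) => _ a.
    by have [//|e Be he] := hP a; exists e => //; rewrite he.
  apply: (@card_le_rel _ _ _ _ (fun p e => B (tag p) e /\ h (tag p) e = Some p)).
    move=> [j a] /= /andP[nj jm]; have j0 := leq_ltn_trans (leq0n _) nj.
    by have [e Be he] := hP j j0 a; exists e => //; exists j => //; rewrite nj.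
  move=> p p' e /andP[np _] /andP[np' _] [Be he] [Be' he'].
  have pp' : tag p = tag p'.
    apply: (basis_level_inj H_orthogonal B_basis _ _ Be Be').
      exact: leq_ltn_trans _ np.
    exact: leq_ltn_trans _ np'.
  by move: he he'; rewrite pp' => -> [].
split=> [full beta bE n n0|cP n].
  apply: contrapT => nex.
  have Mb m : (Mid n m #<= [set: beta])%card.
    have [mn|nm] := leqP m n.
      have -> : Mid n m = set0; last exact: card_ge0.
      apply/seteqP; split=> // e [j /andP[nj jm]].
      by have := leq_trans nj (leq_trans jm mn); rewrite ltnn.
    rewrite (card_le_eql (BM n m)); apply: card_leNgt => bM.
    by apply: nex; exists m.
  apply: (card_lt_geF bE); apply: (card_le_trans (full n)).
  apply: card_le_trans (card_le_bigcup_nondecreasing _ Mb).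
    by apply: subset_card_le => e [j nj Be]; exists j => //; exists j => //; rewrite nj leqnn.
  by move=> m m' mm' e [j /andP[nj jm] Be]; exists j => //; rewrite nj (leq_trans jm).
apply: card_leNgt => FE.
have TF : ([set: set_type (F n.+1)] #= F n.+1)%card := card_setT _.
have FF : (F n.+1 #<= F n)%card.
  by apply: subset_card_le => e [j nj Be]; exists j => //; exact: ltnW.
have [||m nm] := cP (set_type (F n.+1)) _ n.+1.
- exact: card_le_lt_trans (card_leW TF) (card_le_lt_trans FF FE).
- by [].
move=> TM; apply: (card_lt_geF TM); rewrite (card_le_eqr TF) -(card_le_eql (BM _ _)).
by apply: subset_card_le => e [j /andP[nj _] Be]; exists j.
Qed.

End tails.

Lemma has_dim_eq (R : realType) (H : hilbertType R) (Z : set H) T U (A : set T) (B : set U) :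
  (A #= B)%card -> has_dim Z A -> has_dim Z B.
Proof. by move=> AB [E bE EA]; exists E => //; exact: card_eq_trans EA AB. Qed.

Theorem theorem3p3 (R : realType) (H : hilbertType R)
    (alpha : Type) (alpha_ : nat -> Type) (Rg : set H)
    (dimH : has_dim [set: H] [set: alpha])
    (alpha_infinite : ([set: nat] #<= [set: alpha])%card)
    (Rg_range : operator_range Rg)
    (Rg_type : range_of_type alpha_ Rg)
    (Rg_dense : dense Rg) :
  [<-> (* (a) *)
       exists Z : set H, [/\ closed_subspace Z, Z `&` Rg = [set 0] &
         has_dim Z [set: alpha]];
       (* (b) *)
       forall beta : Type, ([set: beta] #< [set: alpha])%card ->
         exists Y : set H, [/\ closed_subspace Y, Y `&` Rg = [set 0] &
           dim_gt Y [set: beta]];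
       (* (c) *)
       forall beta : Type, ([set: beta] #< [set: alpha])%card ->
         forall n : nat, (0 < n)%N -> exists2 m : nat, (n < m)%N &
           ([set: beta] #<
             [set p : {j : nat & alpha_ j} | (n < tag p <= m)%N])%card;
       (* (d) *)
       forall K : set H, linear_subspace K -> K `<=` Rg -> closed K ->
         has_dim (orthocomplement K) [set: alpha];
       (* (e) *)
       exists Rg' : set H, [/\ operator_range Rg', dense Rg' &
         Rg' `&` Rg = [set 0]];
       (* (f) *)
       exists U : {linear H -> H}, unitary_operator U /\
         (U @` Rg) `&` Rg = [set 0];
       (* (g) *)
       exists W : set H, [/\ closed_subspace W, W `&` Rg = [set 0] &
         orthocomplement W `&` Rg = [set 0]]] /\
  (forall W : set H, closed_subspace W -> W `&` Rg = [set 0] ->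
    orthocomplement W `&` Rg = [set 0] ->
    has_dim W [set: alpha] /\ has_dim (orthocomplement W) [set: alpha]).
Proof.
have [H_ [Hcl Hort Hdim RgE]] := Rg_type.
have /choice[B BP] n : exists b : set H, (0 < n)%N ->
    orthonormal_basis (H_ n) b /\ (b #= [set: alpha_ n])%card.
  by have [/Hdim[b bb bA]|_] := ltnP 0 n; [exists b|exists set0].
have Bb n : (0 < n)%N -> orthonormal_basis (H_ n) (B n) by move=> /BP[].
have BA n : (0 < n)%N -> (B n #= [set: alpha_ n])%card by move=> /BP[].
have {}RgE : Rg = weighted_range H_ := RgE.
have lR : linear_subspace Rg.
  have [K [T [_ ->]]] := Rg_range; apply/linear_subspaceP; split.
    by exists 0; rewrite ?linear0.
  by move=> a _ _ [x _ <-] [y _ <-]; exists (a *: x + y); rewrite ?linearP.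
have Rdense := Rg_dense; rewrite RgE in Rdense.
have [E0 bE0 E0A] := dimH.
set E := tail_basis B 0.
have EA : (E #= [set: alpha])%card.
  apply: card_eq_trans E0A; apply: basis_card_eq bE0.
  exact: total_basis Hort Bb Rdense.
have dimEA Z : has_dim Z E <-> has_dim Z [set: alpha].
  by split; apply: has_dim_eq; rewrite // card_eq_sym.
have ltEA (beta : Type) : ([set: beta] #< E)%card <-> ([set: beta] #< [set: alpha])%card.
  by split=> /card_lt_le_trans; apply; [exact: card_leW|exact: card_geW].
pose full := full_tails B.
have b_full : (forall beta : Type, ([set: beta] #< [set: alpha])%card ->
    exists Y : set H, [/\ closed_subspace Y, Y `&` Rg = [set 0] & dim_gt Y [set: beta]]) -> full.
  move=> bP; apply: (large_subspace_full_tails Hcl Hort Bb Rdense) => beta /ltEA/bP.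
  by rewrite RgE.
have d_full : (forall K : set H, linear_subspace K -> K `<=` Rg -> closed K ->
    has_dim (orthocomplement K) [set: alpha]) -> full.
  move=> dP; apply: (orthocomplement_full_tails Hcl Hort Bb Rdense) => K lK KR cK.
  by apply/dimEA/dP => //; rewrite RgE.
have full_d : full -> forall K : set H, linear_subspace K -> K `<=` Rg -> closed K ->
    has_dim (orthocomplement K) [set: alpha].
  move=> fl K lK KR cK; apply/dimEA.
  by apply: (full_tails_orthocomplement Hcl Hort Bb Rdense) => //; rewrite -RgE.
have e_full : (exists Rg' : set H,
    [/\ operator_range Rg', dense Rg' & Rg' `&` Rg = [set 0]]) -> full.
  move=> [Rg' [oR dR RR]]; apply: (disjoint_range_full_tails Hcl Hort Bb Rdense oR dR).
  by rewrite -RgE.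
have full_g : full -> exists W : set H, [/\ closed_subspace W, W `&` Rg = [set 0] &
         orthocomplement W `&` Rg = [set 0]].
  by rewrite RgE; exact: (full_tails_complements Hcl Hort Bb Rdense).
have full_c := full_tailsP Hort Bb BA.
have dimW W : closed_subspace W -> orthocomplement W `&` Rg = [set 0] -> has_dim W [set: alpha].
  rewrite RgE in lR *; move=> cW W'R; apply/dimEA.
  exact: (complement_dim Hcl Hort Bb Rdense lR cW W'R).
have g_f : (exists W : set H, [/\ closed_subspace W, W `&` Rg = [set 0] &
         orthocomplement W `&` Rg = [set 0]]) ->
    exists U : {linear H -> H}, unitary_operator U /\ (U @` Rg) `&` Rg = [set 0].
  move=> [W [cW WR W'R]]; have [U [uU UW]] := exists_reflection cW.
  exists U; split=> //; apply/seteqP; split=> [_ [[x Rx <-] RUx]|_ ->]; last first.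
    by split; [exists 0; rewrite ?linear0 //|]; exact: subspace0.
  have [Wx W'x] := UW x.
  have pl : x + U x = 0.
    have : (W `&` Rg) (x + U x) by split=> //; exact: subspaceD.
    by rewrite WR.
  have mi : x - U x = 0.
    have : (orthocomplement W `&` Rg) (x - U x) by split=> //; exact: subspaceB.
    by rewrite W'R.
  have xU : x = U x by apply/eqP; rewrite -subr_eq0 mi.
  have : 2%:R *: x = 0 by rewrite scaler_nat mulr2n {2}xU.
  by move=> /eqP; rewrite scaler_eq0 pnatr_eq0 /= => /eqP x0; rewrite /= x0 linear0.
have f_e : (exists U : {linear H -> H}, unitary_operator U /\ (U @` Rg) `&` Rg = [set 0]) ->
    exists Rg' : set H, [/\ operator_range Rg', dense Rg' & Rg' `&` Rg = [set 0]].
  move=> [U [[iU rU] URR]]; exists (U @` Rg); split=> //.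
    have [K [T [[M MP] RT]]] := Rg_range; exists K, (U \o T); split.
      exists M => x /=; apply: le_trans (MP x); rewrite le_eqVlt; apply/orP; left.
      have : hnorm (U (T x)) ^+ 2 == hnorm (T x) ^+ 2.
        by apply/eqP; apply: complexI; rewrite !hnorm_sqr; exact: iU.
      by rewrite eqrXn2 ?hnorm_ge0 // => /eqP ->.
    by rewrite RT image_comp.
  apply/dense_hnormP => x e e0; have : range U x by rewrite rU.
  move=> [y _ <-]; have /dense_hnormP/(_ y e e0)[z Rz yz] := Rg_dense.
  exists (U z); first by exists z.
  rewrite -linearB; have : hnorm (U (y - z)) ^+ 2 == hnorm (y - z) ^+ 2.
    by apply/eqP; apply: complexI; rewrite !hnorm_sqr; exact: iU.
  by rewrite eqrXn2 ?hnorm_ge0 // => /eqP ->.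
split; last first.
  move=> W cW WR W'R; split; first exact: dimW.
  by apply: dimW; rewrite ?orthocomplementK //; exact: orthocomplement_closed.
tfae.
- move=> [Z [cZ ZR [G bG GA]]] beta bA; exists Z; split=> //; exists G => //.
  exact: card_lt_le_trans bA (card_geW GA).
- by move=> /b_full/full_c fc beta /ltEA; exact: fc.
- by move=> cP; apply: full_d; apply/full_c => beta /ltEA; exact: cP.
- by move=> /d_full/full_g/g_f/f_e.
- by move=> /e_full/full_g/g_f.
- by move=> /f_e/e_full/full_g.
- by move=> [W [cW WR W'R]]; exists W; split=> //; exact: dimW.
Qed.
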